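(* Let $B$ be a standard one-dimensional Brownian motion, let $0<\gamma<1/2$, and let $C_\gamma\subset[1,2]$ and $f_\gamma$ be the middle $(1-2\gamma)$-Cantor set and the corresponding Cantor function on the interval $[1,2]$. Then $\mathbb{P}(\mathcal{Z}(B-f_\gamma)\cap C_\gamma\neq\emptyset)>0$ if and only if $\gamma\neq 1/4$.
   Context: $B=(B(t))_{t\ge0}$ starts at $0$. For a real function $g$ on a subset of $[0,\infty)$, $\mathcal{Z}(g)$ is the set of zeros of $g$ in $(0,\infty)$. Cantor set: let $I=[1,2]$. Let $\mathfrak{C}_{\gamma,1}$ consist of the two closed subintervals of $I$ of length $\gamma|I|$ sharing respectively the left and the right endpoint with $I$. Recursively, $\mathfrak{C}_{\gamma,n+1}$ consists of, for each $J\in\mathfrak{C}_{\gamma,n}$, the two closed subintervals of $J$ of length $\gamma^{n+1}|I|$ sharing respectively the left and the right endpoint with $J$. Let $C_{\gamma,n}$ be the union of the intervals in $\mathfrak{C}_{\gamma,n}$, and $C_\gamma=\bigcap_{n\ge1}C_{\gamma,n}$. Cantor function: $f_{\gamma,1}$ is $0$ at the left endpoint of $I$, $1$ at the right endpoint, $1/2$ on $I\setminus C_{\gamma,1}$, and linear on each interval of $\mathfrak{C}_{\gamma,1}$ (continuous). Recursively, $f_{\gamma,n+1}$ agrees with $f_{\gamma,n}$ off $C_{\gamma,n}$, and for every $J=[s,t]\in\mathfrak{C}_{\gamma,n}$ it agrees with $f_{\gamma,n}$ at $s$ and $t$, equals $(f_{\gamma,n}(s)+f_{\gamma,n}(t))/2$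 on $J\setminus C_{\gamma,n+1}$ and is linear on each interval of $\mathfrak{C}_{\gamma,n+1}$ (continuous). The functions $f_{\gamma,n}$ converge uniformly on $I$, and $f_\gamma=\lim_n f_{\gamma,n}$. The function is extended by $f_\gamma=0$ on $[0,1)$ and $f_\gamma=1$ on $(2,\infty)$. *)

(* Defs.v *)
From HB Require Import structures.
From mathcomp Require Import all_boot all_order all_algebra.
From mathcomp Require Import all_classical all_reals all_analysis.

Set Implicit Arguments.
Unset Strict Implicit.
Unset Printing Implicit Defensive.

Import Order.TTheory GRing.Theory Num.Theory.
Import numFieldNormedType.Exports.

Local Open Scope classical_set_scope.
Local Open Scope ring_scope.

(* Taking some of the [A i] equal to [setT] gives the product rule for every
   subfamily. *)
Definition mutually_independent (d : measure_display) (T : measurableType d)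
    (R : realType) (P : probability T R) (n : nat) (X : 'I_n -> T -> R) : Prop :=
  forall A : 'I_n -> set R, (forall i, measurable (A i)) ->
    P (\bigcap_(i in [set: 'I_n]) (X i @^-1` A i)) =
    (\prod_(i < n) P (X i @^-1` A i))%E.

(* Only the times t >= 0 matter; the random variables [B t] with t < 0 are
   unconstrained.  The second parameter of [normal_prob] is the standard
   deviation.  Paths are continuous surely, not just almost surely, so that
   events such as "B hits f on C" are measurable. *)
Record standard_brownian_motion (d : measure_display) (T : measurableType d)
    (R : realType) (P : probability T R) (B : R -> {RV P >-> R}) : Prop := {
  bm_start : forall w, B 0 w = 0 ;
  bm_independent_increments : forall (n : nat) (t : nat -> R),
    0 <= t 0%N -> (forall i, t i <= t i.+1) ->
    mutually_independent P
      (fun (i : 'I_n) w => B (t i.+1) w - B (t i) w) ;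
  bm_normal_increments : forall s t : R, 0 <= s -> s < t ->
    forall A : set R, measurable A ->
      P ((fun w => B t w - B s w) @^-1` A) =
      normal_prob 0 (Num.sqrt (t - s)) A ;
  bm_continuous_paths : forall w,
    {within `[0, +oo[, continuous (fun t : R => B t w : R)}
}.

Definition zeros (R : realType) (g : R -> R) : set R :=
  [set t | 0 < t /\ g t = 0].

Section cantor.
Variables (R : realType) (gamma : R).

(* A pair (s, t) encodes the interval [s, t].  Stage 0 is the single interval
   I = [1, 2], for which |I| = 1. *)
Fixpoint cantor_intervals (n : nat) : seq (R * R) :=
  if n is m.+1 then
    flatten [seq [:: (J.1, J.1 + gamma ^+ m.+1); (J.2 - gamma ^+ m.+1, J.2)]
            | J <- cantor_intervals m]
  else [:: (1, 2)].

Definition cantor_stage (n : nat) : set R :=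
  [set x | exists2 J, J \in cantor_intervals n & x \in `[J.1, J.2]].

Definition cantor_set : set R :=
  \bigcap_(n in [set n | (1 <= n)%N]) cantor_stage n.

(* The affine function through (a, ya) and (b, yb). *)
Definition affine_interp (a b ya yb x : R) : R :=
  ya + (yb - ya) * ((x - a) / (b - a)).

(* The modification of [f] on J = [s, t] when the two children of J have
   length [l]. *)
Definition cantor_refine (l : R) (f : R -> R) (J : R * R) (x : R) : R :=
  let: (s, t) := J in
  let mid := (f s + f t) / 2 in
  if x <= s + l then affine_interp s (s + l) (f s) mid x
  else if x < t - l then mid
  else affine_interp (t - l) t mid (f t) x.

(* Starting at n = 0 from the affine function with values 0 at 1 and 1 at 2,
   the recursion step yields the usual f_1 for n = 1.  When 0 < gamma < 1/2 the
   intervals of a given stage are disjoint, so at most one J contains x. *)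
Fixpoint cantor_approx (n : nat) : R -> R :=
  if n is m.+1 then
    let f := cantor_approx m in
    fun x =>
      if [seq J <- cantor_intervals m | x \in `[J.1, J.2]] is J :: _
      then cantor_refine (gamma ^+ m.+1) f J x
      else f x
  else fun x => x - 1.

Definition cantor_function (x : R) : R :=
  if x < 1 then 0 else if 2 < x then 1
  else limn (fun n => cantor_approx n x).

End cantor.

(* Main.v *)
Require Import Defs.
From HB Require Import structures.
From mathcomp Require Import all_boot all_order all_algebra.
From mathcomp Require Import all_classical all_reals all_analysis.
From mathcomp Require Import measurable_realfun ring lra zify.

(* For j < 2^n let a_n(j) be the left endpoint of the stage-n interval with address j, so
   that f(a_n(j)) = j / 2^n.  By compactness, B hits f on the Cantor set iff for every
   e > 0 some grid point satisfies |B(a_n(j)) - j / 2^n| <= e.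

   If gamma <> 1/4, put windows of radius eps / 2^N around the points j / 2^N.  The
   probabilities that B(a_N(j)) lies in its window add up to at least c eps.  If the
   addresses i < j first differ after m digits, the increment has standard deviation of
   order s^m with s = sqrt gamma, and the Gaussian factor penalises the required jump
   (j - i) / 2^N.  Bounding this factor by 1 when 2 s > 1, and summing it over j - i
   when 2 s < 1, one gets a sum over pairs of at most C eps^2 (1 + rho + rho^2 + ...) with
   rho = min (2 s) (1 / (2 s)) < 1.  Bonferroni's inequality with a small fixed eps bounds
   the probability of a window hit from below, uniformly in N.

   If gamma = 1/4, take depth 3 r and windows of radius 4^-r.  After a first window hit
   at address i, each zero digit of i among the 2 r leading ones opens a block of later
   addresses that contributes a fixed multiple of 2^r to the expected number of further
   hits (of doubled windows), while the unconditional expectation is at most 4 * 2^r.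
   Hence the first-hit address has K zero digits there with probability O(1 / K), and the
   addresses with fewer than K zero digits are too few to matter.  Chaining along the tree
   of intervals controls the oscillation of B between points of the grid. *)

Set Implicit Arguments.
Unset Strict Implicit.
Unset Printing Implicit Defensive.

Import Order.TTheory GRing.Theory Num.Theory.
Import numFieldNormedType.Exports.

Local Open Scope classical_set_scope.
Local Open Scope ring_scope.

Lemma eq_ler (R : numDomainType) (x y : R) : x = y -> x <= y.
Proof. by move=> ->. Qed.

Lemma near_infty_expr_lt (R : archiRealFieldType) (q e : R) : 0 <= q < 1 -> 0 < e ->
  \forall n \near \oo, q ^+ n < e.
Proof.
move=> /andP[q0 q1] e0; apply: (cvgr_lt 0) => //.
by apply: cvg_expr; rewrite ger0_norm.
Qed.

Lemma sum_expr_le (R : realFieldType) (q : R) n :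
  0 <= q < 1 -> \sum_(i < n) q ^+ i <= (1 - q)^-1.
Proof.
move=> /andP[q0 q1]; have q10 : 0 < 1 - q by rewrite subr_gt0.
rewrite -[leRHS]mul1r ler_pdivlMr// mulrC -opprB mulNr -subrX1 opprB.
by rewrite lerBlDr lerDl exprn_ge0.
Qed.

Lemma expRN_le_inv_sqr (R : realType) (x : R) :
  0 <= x -> expR (- x) <= 4 / (1 + x) ^+ 2.
Proof.
move=> x0; have := expR_ge1Dxn 1 x0; rewrite (_ : 2`! = 2)%N // => expx.
have x10 : 0 < 1 + x by lra.
rewrite expRN -[leRHS]invrK lef_pV2 ?posrE ?expR_gt0 ?invr_gt0 ?divr_gt0 ?exprn_gt0//.
by rewrite invf_div; nra.
Qed.

Section normal_estimates.
Context {R : realType}.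
Implicit Types m s u v w x y c : R.

Local Notation mu := (@lebesgue_measure R).

Lemma normal_peak_le s : 0 < s -> normal_peak s <= s^-1.
Proof.
move=> s0; have s20 : 0 < s ^+ 2 *+ 2 * pi by rewrite mulr_gt0 ?pi_gt0 ?mulrn_wgt0 ?exprn_gt0.
rewrite /normal_peak -mulrnAl lef_pV2 ?posrE ?sqrtr_gt0//.
rewrite -[leLHS]gtr0_norm// -[leLHS]sqrtr_sqr ler_sqrt ?(ltW s20)//.
by have := pi_ge2 R; have := exprn_gt0 2 s0; nra.
Qed.

Lemma normal_peak_ge s : 0 < s -> (3 * s)^-1 <= normal_peak s.
Proof.
move=> s0; have s20 : 0 < s ^+ 2 *+ 2 * pi by rewrite mulr_gt0 ?pi_gt0 ?mulrn_wgt0 ?exprn_gt0.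
rewrite /normal_peak -mulrnAl lef_pV2 ?posrE ?sqrtr_gt0// ?mulr_gt0//.
rewrite -[leRHS]gtr0_norm ?mulr_gt0// -[leRHS]sqrtr_sqr ler_sqrt ?sqr_ge0//.
by have := @pihalf_lt2 R; have := exprn_gt0 2 s0; rewrite exprMn; nra.
Qed.

Lemma measurable_normal_pdf_EFin m s D :
  measurable_fun D (fun x => (normal_pdf m s x)%:E).
Proof.
by apply/measurable_EFinP; apply: measurable_funTS; exact: measurable_normal_pdf.
Qed.

Lemma normal_prob_le m s c (A : set R) : measurable A ->
  (forall x, A x -> normal_pdf m s x <= c) -> (normal_prob m s A <= c%:E * mu A)%E.
Proof.
move=> mA pdfc; rewrite -integral_cst//; apply: ge0_le_integral => //.
- by move=> x _; rewrite lee_fin normal_pdf_ge0.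
- exact: measurable_normal_pdf_EFin.
Qed.

Lemma normal_prob_ge m s c (A : set R) : measurable A -> 0 <= c ->
  (forall x, A x -> c <= normal_pdf m s x) -> (c%:E * mu A <= normal_prob m s A)%E.
Proof.
move=> mA c0 cpdf; rewrite -integral_cst//; apply: ge0_le_integral => //.
exact: measurable_normal_pdf_EFin.
Qed.

Lemma lebesgue_measure_segment u v : u <= v -> mu `[u, v] = (v - u)%:E.
Proof.
move=> uv; rewrite lebesgue_measure_itv/= lte_fin; case: ltP => [_|vu].
  by rewrite EFinB.
by rewrite (@le_anti _ _ u v) ?uv// subrr.
Qed.

Lemma normal_prob_itv_le m s u v w : 0 < s -> u <= v ->
  (forall x, u <= x <= v -> w <= (x - m) ^+ 2) ->
  (normal_prob m s `[u, v] <= ((v - u) / s * expR (- w / (s ^+ 2 *+ 2)))%:E)%E.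
Proof.
move=> s0 uv wle; rewrite -mulrA EFinM muleC -lebesgue_measure_segment//.
apply: normal_prob_le => // x; rewrite /= in_itv/= => /wle wx.
rewrite normal_pdfE ?gt_eqF// ler_pM ?normal_peak_ge0 ?normal_fun_ge0 ?normal_peak_le//.
rewrite /normal_fun ler_expR !mulNr lerN2 ler_pM2r// invr_gt0.
by rewrite mulrn_wgt0// exprn_gt0.
Qed.

Lemma normal_prob_itv_ge m s u v w : 0 < s -> u <= v ->
  (forall x, u <= x <= v -> (x - m) ^+ 2 <= w) ->
  (((v - u) / (3 * s) * expR (- w / (s ^+ 2 *+ 2)))%:E <= normal_prob m s `[u, v])%E.
Proof.
move=> s0 uv lew; have s30 : 0 <= (3 * s)^-1 by rewrite invr_ge0 mulr_ge0// ltW.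
rewrite -mulrA EFinM muleC -lebesgue_measure_segment//.
apply: normal_prob_ge => //; first by rewrite mulr_ge0 ?expR_ge0.
move=> x; rewrite /= in_itv/= => /lew xw.
rewrite normal_pdfE ?gt_eqF// ler_pM ?expR_ge0 ?normal_peak_ge//.
rewrite /normal_fun ler_expR !mulNr lerN2 ler_pM2r// invr_gt0.
by rewrite mulrn_wgt0// exprn_gt0.
Qed.

Lemma normal_pdf_sqrt2 m s x : 0 < s ->
  normal_pdf m s x =
  Num.sqrt 2 * expR (- ((x - m) ^+ 2 / (s ^+ 2 *+ 4))) * normal_pdf m (Num.sqrt 2 * s) x.
Proof.
move=> s0; have sqrt20 : 0 < Num.sqrt 2 :> R by rewrite sqrtr_gt0.
rewrite !normal_pdfE ?gt_eqF ?mulr_gt0// mulrACA; congr (_ * _).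
  rewrite /normal_peak exprMn sqr_sqrtr//.
  rewrite (_ : 2 * s ^+ 2 * pi *+ 2 = 2 * (s ^+ 2 * pi *+ 2)); last by ring.
  by rewrite sqrtrM// invfM mulrA divff ?mul1r// gt_eqF.
rewrite /normal_fun -expRD exprMn sqr_sqrtr//; congr expR.
by field; rewrite gt_eqF.
Qed.

(* Half of the Gaussian exponent is enough for an integrable density, the one with standard
   deviation [Num.sqrt 2 * s]; the other half is bounded on the tail. *)
Lemma normal_prob_tail m s y : 0 < s -> 0 <= y ->
  (normal_prob m s [set x | (y < `|x - m|)%R] <=
   (Num.sqrt 2 * expR (- (y ^+ 2 / (s ^+ 2 *+ 4))))%:E)%E.
Proof.
move=> s0 y0; set D := [set x | _]; set c := Num.sqrt 2 * _; pose s' := Num.sqrt 2 * s.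
have mD : measurable D.
  rewrite -[D]setTI (_ : D = (fun x => `|x - m|) @^-1` `]y, +oo[); last first.
    by apply/seteqP; split=> x /=; rewrite in_itv/= andbT.
  suff : measurable_fun setT (fun x : R => `|x - m|) by apply.
  by apply: measurableT_comp => //; exact: measurable_funB.
have c0 : 0 <= c by rewrite mulr_ge0 ?expR_ge0.
have mpdf E := measurable_normal_pdf_EFin m s' E.
have pdf0 x : (0 <= (normal_pdf m s' x)%:E)%E by rewrite lee_fin normal_pdf_ge0.
apply: (@le_trans _ _ (\int[mu]_(x in D) (c%:E * (normal_pdf m s' x)%:E))%E).
  apply: ge0_le_integral => //.
  - by move=> x _; rewrite lee_fin normal_pdf_ge0.
  - exact: measurable_normal_pdf_EFin.
  - by apply: emeasurable_funM => //; exact: mpdf.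
  move=> x yx; rewrite -EFinM lee_fin normal_pdf_sqrt2// ler_wpM2r ?normal_pdf_ge0//.
  rewrite ler_wpM2l// ler_expR lerN2 ler_pM2r ?invr_gt0 ?mulrn_wgt0 ?exprn_gt0//.
  by rewrite -[leRHS]real_normK ?num_real// ler_pXn2r ?nnegrE// ltW.
rewrite (ge0_integralZl mu mD (mpdf D))//.
rewrite -[leRHS]mule1 lee_wpmul2l ?lee_fin// -(integral_normal_pdf m s').
by apply: ge0_subset_integral => //; exact: mpdf.
Qed.

Lemma normal_prob_tail_inv4 m s y : 0 < s -> 0 < y ->
  (normal_prob m s [set x | (y < `|x - m|)%R] <= (128 * (s / y) ^+ 4)%:E)%E.
Proof.
move=> s0 y0; apply: (le_trans (normal_prob_tail m s0 (ltW y0))); rewrite lee_fin.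
set z := y ^+ 2 / _; have z0 : 0 < z by rewrite divr_gt0 ?mulrn_wgt0 ?exprn_gt0.
have -> : 128 * (s / y) ^+ 4 = 2 * (4 / z ^+ 2) by rewrite /z; field; rewrite !gt_eqF.
have sqrt2 : Num.sqrt 2 <= 2 :> R.
  by rewrite -[leRHS]gtr0_norm// -sqrtr_sqr ler_sqrt//; lra.
rewrite ler_pM ?expR_ge0//; apply: (le_trans (expRN_le_inv_sqr (ltW z0))).
by rewrite ler_pM2l// lef_pV2 ?posrE ?exprn_gt0//; nra.
Qed.

End normal_estimates.

Section pairs_by_common_prefix.
Context {V : nmodType}.
Implicit Types p : nat -> nat -> V.

(* The pairs of binary addresses of length [N] whose common prefix is [q], when [l] digits
   follow the one at which they separate. *)
Definition split_sum p l q : V :=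
  \sum_(x < 2 ^ l) \sum_(y < 2 ^ l) p (q.*2 * 2 ^ l + y)%N (q.*2.+1 * 2 ^ l + x)%N.

Lemma sum_pairs_split_sum p N :
  \sum_(j < 2 ^ N) \sum_(i < j) p i j =
  \sum_(m < N) \sum_(q < 2 ^ m) split_sum p (N - m.+1) q.
Proof.
elim: N p => [|N ih] p; first by rewrite big_ord1 !big_ord0.
pose p' i j := p (2 ^ N + i)%N (2 ^ N + j)%N.
have shift m q : (m < N)%N ->
    split_sum p' (N - m.+1) q = split_sum p (N - m.+1) (2 ^ m + q)%N.
  move=> mN; have NE : (2 ^ N = (2 ^ m).*2 * 2 ^ (N - m.+1))%N.
    by rewrite -mul2n -expnS -expnD subnKC.
  apply: eq_bigr => x _; apply: eq_bigr => y _.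
  by rewrite /p' NE; congr p; rewrite ?doubleD; ring.
rewrite big_ord_recl /= big_ord1 subn1 expnS mul2n -addnn big_split_ord /=.
under [X in _ + X]eq_bigr do rewrite big_split_ord.
rewrite big_split /= ih -[X in _ + (_ + X)]/(\sum_(j < 2 ^ N) \sum_(i < j) p' i j) ih.
rewrite addrCA; congr (_ + _).
  by apply: eq_bigr => x _; apply: eq_bigr => y _; rewrite mul0n mul1n.
rewrite -big_split; apply: eq_bigr => m _ /=.
rewrite /bump /= add1n subSS expnS mul2n -addnn big_split_ord /=; congr (_ + _).
by apply: eq_bigr => q _; rewrite shift.
Qed.

End pairs_by_common_prefix.

Lemma sum_antidiagonals_le (R : numDomainType) (h : nat -> R) n : (forall k, 0 <= h k) ->
  \sum_(x < n) \sum_(y < n) h (x + y)%N <= \sum_(k < n + n) k.+1%:R * h k.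
Proof.
move=> h0.
have row_le (x : 'I_n) : \sum_(y < n) h (x + y)%N <= \sum_(k < n + n) (x <= k)%:R * h k.
  have -> : (n + n = x + (n + (n - x)))%N by rewrite addnCA subnKC// ltnW.
  rewrite !big_split_ord /= ler_wpDl ?sumr_ge0// => [k _|]; first by rewrite mulr_ge0.
  rewrite ler_wpDr ?sumr_ge0// => [k _|]; first by rewrite mulr_ge0.
  by apply: ler_sum => k _; rewrite leq_addr mul1r.
have count_le k : (\sum_(x < n) (x <= k) <= k.+1)%N.
  apply: leq_trans (geq_minr n k.+1); apply: eq_leq.
  rewrite -(big_mkord xpredT (fun x => (x <= k) : nat)); elim: n {row_le} => [|m ih].
    by rewrite big_geq// min0n.
  by rewrite big_nat_recr//= ih; lia.
apply: (le_trans (ler_sum _ (fun x _ => row_le x))).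
rewrite exchange_big /=; apply: ler_sum => k _.
by rewrite -mulr_suml ler_wpM2r// -natr_sum ler_nat.
Qed.

Section gaussian_sums.
Context {R : realType}.

Lemma gauss_le_telescope (c x : R) : 0 < c -> 0 <= x ->
  (x + 1) * expR (- ((x + 1) ^+ 2 * c)) <=
  2 / c * ((1 + x * (x + 1) * c)^-1 - (1 + (x + 1) * (x + 2) * c)^-1).
Proof.
move=> c0 x0; set u := 1 + x * (x + 1) * c; set v := 1 + (x + 1) * (x + 2) * c.
have u0 : 0 < u by rewrite ltr_pwDl// !mulr_ge0 ?addr_ge0// ltW.
have v0 : 0 < v by rewrite ltr_pwDl// !mulr_ge0 ?addr_ge0// ltW.
set z := (x + 1) ^+ 2 * c; have z0 : 0 <= z by rewrite mulr_ge0 ?sqr_ge0// ltW.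
have z10 : 0 < 1 + z by rewrite ltr_pwDl.
have -> : 2 / c * (u^-1 - v^-1) = (x + 1) * (4 / (u * v)).
  by rewrite /u /v in u0 v0 *; field; rewrite !gt_eqF.
rewrite ler_wpM2l ?addr_ge0//; apply: (le_trans (expRN_le_inv_sqr z0)).
rewrite ler_wpM2l// lef_pV2 ?posrE ?exprn_gt0 ?mulr_gt0//.
rewrite -subr_ge0 (_ : _ - _ = ((x + 1) * c) ^+ 2) ?sqr_ge0//.
by rewrite /u /v /z; ring.
Qed.

Lemma sum_gauss_le (c : R) n : 0 < c ->
  \sum_(k < n) k.+1%:R * expR (- (k.+1%:R ^+ 2 * c)) <= 2 / c.
Proof.
move=> c0; pose u (k : nat) : R := (1 + k%:R * (k%:R + 1) * c)^-1.
apply: (@le_trans _ _ (\sum_(k < n) 2 / c * (u k - u k.+1))).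
  apply: ler_sum => k _; have := gauss_le_telescope c0 (ler0n R k).
  by rewrite /u -[k.+1%:R]natr1 (_ : 2 = 1 + 1 :> R)// addrA.
rewrite -mulr_sumr -(big_mkord xpredT (fun k => u k - u k.+1)).
rewrite (telescope_sumr_eq (fun k => - u k))// => [|k _]; last by rewrite opprK addrC.
rewrite opprK addrC ler_piMr ?divr_ge0 ?(ltW c0)// /u !mul0r addr0 invr1 lerBlDr lerDl.
by rewrite invr_ge0 addr_ge0// !mulr_ge0// ltW.
Qed.

Lemma sum_gauss_square_le (c : R) n : 0 < c ->
  \sum_(x < n) \sum_(y < n) expR (- ((n + x - y)%:R ^+ 2 * c)) <= 2 / c.
Proof.
move=> c0; apply: le_trans (sum_gauss_le (n + n) c0).
have gauss_ge0 k : 0 <= expR (- (k.+1%:R ^+ 2 * c)) by exact: expR_ge0.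
apply: le_trans (sum_antidiagonals_le n gauss_ge0).
apply: ler_sum => x _; rewrite (reindex_inj rev_ord_inj) /=; apply: ler_sum => y _.
by rewrite (_ : n + x - (n - y.+1) = (x + y).+1)%N//; have := ltn_ord y; lia.
Qed.

Lemma sum_gauss_square_le_card (c : R) n : 0 <= c ->
  \sum_(x < n) \sum_(y < n) expR (- ((n + x - y)%:R ^+ 2 * c)) <= n%:R ^+ 2.
Proof.
move=> c0; apply: (@le_trans _ _ (\sum_(x < n) \sum_(y < n) 1)).
  by do 2!apply: ler_sum => ? _; rewrite -expR0 ler_expR oppr_le0 mulr_ge0 ?sqr_ge0.
by rewrite !sumr_const !card_ord -mulrnA -natrX mulnn.
Qed.

End gaussian_sums.

Definition zero_bits (r n i : nat) : nat := \sum_(r <= l < n) ~~ odd (i %/ 2 ^ l).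

Lemma zero_bits_recr r n i : (r <= n)%N ->
  zero_bits r n.+1 i = (zero_bits r n i + ~~ odd (i %/ 2 ^ n))%N.
Proof. exact: big_nat_recr. Qed.

(* Each zero digit of [i], say at position [l], opens the block of the [2 ^ l] larger numbers
   that agree with [i] above position [l] and have a one there. *)
Lemma zero_bits_le_sum_gt (R : realFieldType) (p : nat -> R) (c : R) r i n : (r <= n)%N ->
  (forall j, 0 <= p j) ->
  (forall l j, (r <= l < n)%N -> ~~ odd (i %/ 2 ^ l)%N -> (j %/ 2 ^ l = (i %/ 2 ^ l).+1)%N ->
    c / 2 ^+ l <= p j) ->
  c * (zero_bits r n i)%:R <= \sum_(j < (i %/ 2 ^ n).+1 * 2 ^ n | (i < j)%N) p j.
Proof.
move=> /subnK <- p0; elim: (n - r)%N => {n} [_|k]; rewrite ?add0n ?addSn.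
  by rewrite /zero_bits big_geq// mulr0 sumr_ge0.
set n := (k + r)%N => ih p_ge.
have rn : (r <= n)%N by rewrite leq_addl.
set q := (i %/ 2 ^ n)%N in ih p_ge *.
have {}ih : c * (zero_bits r n i)%:R <= \sum_(j < q.+1 * 2 ^ n | (i < j)%N) p j.
  by apply: ih => l j /andP[rl ln]; apply: p_ge; rewrite rl ltnW.
have qE : (i %/ 2 ^ n.+1 = q./2)%N by rewrite expnSr divnMA divn2.
rewrite zero_bits_recr// -/q qE natrD mulrDr.
have [q_odd|q_even] := boolP (odd q).
  have -> : (q./2.+1 * 2 ^ n.+1 = q.+1 * 2 ^ n)%N by rewrite expnS; lia.
  by rewrite mulr0 addr0.
have -> : (q./2.+1 * 2 ^ n.+1 = q.+1 * 2 ^ n + 2 ^ n)%N by rewrite expnS; lia.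
have iq : (i < q.+1 * 2 ^ n)%N by rewrite ltn_ceil ?expn_gt0.
rewrite big_split_ord /= lerD// (eq_bigl xpredT) => [|x]; last first.
  by rewrite (leq_trans iq) ?leq_addr.
rewrite (_ : c * _ = \sum_(x < 2 ^ n) c / 2 ^+ n); last first.
  by rewrite sumr_const card_ord -[RHS]mulr_natr natrX divfK ?mulr1// expf_neq0.
apply: ler_sum => x _; apply: p_ge => //; first by rewrite rn ltnSn.
by rewrite divnMDl ?expn_gt0// divn_small// addn0.
Qed.

Lemma sum_expr_zero_bits (R : comPzRingType) (x : R) r k :
  \sum_(i < 2 ^ (k + r)) x ^+ zero_bits r (k + r) i = 2 ^+ r * (1 + x) ^+ k.
Proof.
elim: k => [|k ih].
  rewrite add0n expr0 mulr1 (eq_bigr (fun=> 1)) => [|i _].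
    by rewrite sumr_const card_ord natrX.
  by rewrite /zero_bits big_geq.
rewrite addSn expnS mul2n -addnn big_split_ord /= exprS mulrCA mulrDl mul1r addrC -ih mulr_sumr.
congr (_ + _); apply: eq_bigr => i _; rewrite zero_bits_recr ?leq_addl//.
  rewrite divnDl ?dvdnn// divnn expn_gt0/= divn_small// addn0 addn0; congr (_ ^+ _).
  apply: eq_big_nat => l /andP[_ lt_l]; rewrite divnDl ?dvdn_exp2l ?(ltnW lt_l)//.
  by rewrite oddD -expnB ?(ltnW lt_l)// oddX orbF subn_eq0 leqNgt lt_l.
by rewrite divn_small// addn1 exprS.
Qed.

Lemma ltn_half_exp2 n j : (j./2 < 2 ^ n)%N = (j < 2 ^ n.+1)%N.
Proof. by rewrite expnS mul2n ltn_half_double. Qed.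

Section cantor_cells.
Context {R : realType}.
Variable gamma : R.

(* For [j < 2 ^ n] this is the left endpoint of the stage-[n] interval whose
   address is the binary expansion of [j]; the value [1 + 2 j] at [n = 0] makes it
   increasing in [j] without bounds on [j]. *)
Fixpoint cantor_left (n j : nat) : R :=
  if n is m.+1 then cantor_left m j./2 + (odd j)%:R * ((1 - gamma) * gamma ^+ m)
  else 1 + 2 * j%:R.

Definition cantor_cell (n j : nat) : interval R :=
  `[cantor_left n j, cantor_left n j + gamma ^+ n].

Lemma cantor_leftS_even n j : cantor_left n.+1 j.*2 = cantor_left n j.
Proof. by rewrite /= doubleK odd_double mul0r addr0. Qed.

Lemma cantor_leftS_odd n j :
  cantor_left n.+1 j.*2.+1 = cantor_left n j + (1 - gamma) * gamma ^+ n.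
Proof. by rewrite /= uphalf_double odd_double mul1r. Qed.

Lemma cantor_left_mulX2 n j k : cantor_left (k + n) (j * 2 ^ k) = cantor_left n j.
Proof.
elim: k => [|k ih]; first by rewrite muln1.
by rewrite addSn expnSr mulnA muln2 cantor_leftS_even.
Qed.

Lemma mem_cantor_intervals n J :
  J \in cantor_intervals gamma n <->
  exists2 j, (j < 2 ^ n)%N & J = (cantor_left n j, cantor_left n j + gamma ^+ n).
Proof.
elim: n J => [|n ih] J /=.
  rewrite inE expr0; split=> [/eqP ->|[j]].
    by exists 0%N => //=; congr pair; rewrite ?mulr0 ?addr0.
  by rewrite expn0 ltnS leqn0 => /eqP -> ->; rewrite !mulr0 !addr0.
split=> [/flatten_mapP [I /ih [j jn ->]]|[j jn ->]] /=.
  rewrite !inE => /orP [/eqP -> | /eqP ->].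
    exists j.*2; first by rewrite -ltn_half_exp2 doubleK.
    by rewrite doubleK odd_double mul0r addr0.
  exists j.*2.+1; first by rewrite -ltn_half_exp2 /= uphalf_double.
  by rewrite /= uphalf_double odd_double mul1r; congr pair; rewrite exprS; ring.
apply/flatten_mapP; exists (cantor_left n j./2, cantor_left n j./2 + gamma ^+ n).
  by apply/ih; exists j./2; rewrite ?ltn_half_exp2.
rewrite !inE; case: (odd j) => /=.
  by apply/orP; right; apply/eqP; congr pair; rewrite ?mul1r exprS; ring.
by apply/orP; left; apply/eqP; rewrite mul0r addr0.
Qed.

Lemma cantor_stageE n :
  cantor_stage gamma n = \bigcup_(j < 2 ^ n) [set` cantor_cell n j].
Proof.
apply/seteqP; split=> t.
  by move=> [J /mem_cantor_intervals[j jn ->] tJ]; exists j.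
move=> [j /= jn tj]; exists (cantor_left n j, cantor_left n j + gamma ^+ n) => //.
by apply/mem_cantor_intervals; exists j.
Qed.

Hypotheses (gamma_gt0 : 0 < gamma) (gamma_lt : gamma < 1 / 2).

Let gammaX_gt0 n : 0 < gamma ^+ n. Proof. by rewrite exprn_gt0. Qed.

Let subgammaX_gt0 n : 0 < (1 - 2 * gamma) * gamma ^+ n.
Proof. by rewrite mulr_gt0//; move: gamma_lt; lra. Qed.

Lemma cantor_left_in_cell n j : cantor_left n j \in cantor_cell n j.
Proof. by rewrite in_itv/= lexx lerDl ltW. Qed.

Lemma cantor_left_gap n i j : (i < j)%N ->
  (2 - 2 * gamma) * gamma ^+ n <= cantor_left n j - cantor_left n i.
Proof.
elim: n i j => [|n ih] i j ij /=.
  have ij1 : i%:R + 1 <= j%:R :> R by rewrite natr1 ler_nat.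
  by rewrite expr0 mulr1; move: gamma_gt0; lra.
have [g0 g_lt] := (gamma_gt0, gamma_lt); have gn := gammaX_gt0 n; have sgn := subgammaX_gt0 n.
have child_gap : (2 - 2 * gamma) * gamma ^+ n.+1 <= (1 - gamma) * gamma ^+ n.
  by rewrite exprS; move: gamma_lt; nra.
apply: (le_trans child_gap); case: (ltngtP i./2 j./2) => [/ih|ji|halfE].
- by case: (odd i); case: (odd j) => /=; nra.
- by move/half_leq : (ltnW ij); rewrite leqNgt ji.
- have [-> ->] : odd i = false /\ odd j = true.
    by move: ij; rewrite -[i]odd_double_half -[j]odd_double_half halfE; do 2!case: odd; lia.
  by rewrite halfE /=; lra.
Qed.

Lemma cantor_left_le n i j : (i <= j)%N -> cantor_left n i <= cantor_left n j.
Proof.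
rewrite leq_eqVlt => /predU1P[-> //|ij]; rewrite -subr_ge0.
apply: le_trans (cantor_left_gap n ij); rewrite mulr_ge0 ?(ltW (gammaX_gt0 n))//.
by move: gamma_lt; lra.
Qed.

Lemma cantor_cell_inj n i j t : t \in cantor_cell n i -> t \in cantor_cell n j -> i = j.
Proof.
rewrite !in_itv/= => ti tj; have sgn := subgammaX_gt0 n; have gn := gammaX_gt0 n.
by case: (ltngtP i j) => // /(cantor_left_gap n) ij; exfalso; lra.
Qed.

Lemma cantor_cellS_le n j : (cantor_cell n.+1 j <= cantor_cell n j./2)%O.
Proof.
have [g0 g_lt] := (gamma_gt0, gamma_lt); have gn := gammaX_gt0 n; have sgn := subgammaX_gt0 n.
rewrite subitvE !bnd_simp /= exprS.
by case: (odd j); rewrite ?mul1r ?mul0r; apply/andP; split; nra.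
Qed.

Lemma cantor_cell_le n k j : (cantor_cell (k + n) j <= cantor_cell n (j %/ 2 ^ k))%O.
Proof.
elim: k j => [|k ih] j; first by rewrite divn1.
by rewrite expnS divnMA divn2; apply: le_trans (ih _); exact: cantor_cellS_le.
Qed.

Lemma cantor_left_ge1 n j : 1 <= cantor_left n j.
Proof.
have := cantor_cell_le 0 n j; rewrite addn0 subitvE !bnd_simp => /andP[+ _].
by apply: le_trans; rewrite lerDl mulr_ge0.
Qed.

Lemma cantor_left_ge0 n j : 0 <= cantor_left n j.
Proof. by apply: le_trans (cantor_left_ge1 n j). Qed.

Lemma cantor_cell_le12 n j : (j < 2 ^ n)%N -> (cantor_cell n j <= `[1, 2])%O.
Proof.
move=> jn; have := cantor_cell_le 0 n j; rewrite addn0 divn_small//.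
by rewrite /cantor_cell/= mulr0 addr0 expr0.
Qed.

(* [m] is the length of the longest common prefix of the two addresses. *)
Lemma cantor_left_split (m l i j q : nat) :
  (i %/ 2 ^ l = q.*2)%N -> (j %/ 2 ^ l = q.*2.+1)%N ->
  (1 - 2 * gamma) * gamma ^+ m <=
  cantor_left (l + m.+1) j - cantor_left (l + m.+1) i <= gamma ^+ m.
Proof.
move=> iE jE; have gm := gammaX_gt0 m.
have := subitvP (cantor_cell_le m.+1 l i) (cantor_left_in_cell _ _).
have := subitvP (cantor_cell_le m.+1 l j) (cantor_left_in_cell _ _).
rewrite iE jE !in_itv/= doubleK uphalf_double odd_double exprS mul0r mul1r addr0.
by move=> /andP[j1 j2] /andP[i1 i2]; apply/andP; split; nra.
Qed.

Lemma cantor_setP t : cantor_set gamma t <->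
  forall n, exists2 j, (j < 2 ^ n)%N & t \in cantor_cell n j.
Proof.
split=> [Ct n|tcell n _]; last first.
  by rewrite cantor_stageE; have [j jn tj] := tcell n; exists j.
have := Ct n.+1 isT; rewrite cantor_stageE => -[j jn tj]; exists j./2.
  by rewrite ltn_half_exp2.
exact: subitvP (cantor_cellS_le n j) _ tj.
Qed.

Lemma cantor_left_in_cantor_set n j : (j < 2 ^ n)%N -> cantor_set gamma (cantor_left n j).
Proof.
move=> jn; apply/cantor_setP => m; case: (leqP n m) => [nm|/ltnW mn].
  exists (j * 2 ^ (m - n))%N.
    by rewrite -[X in (_ < 2 ^ X)%N](subnK nm) expnD mulnC ltn_pmul2l ?expn_gt0.
  by rewrite -(cantor_left_mulX2 n j (m - n)) subnK// cantor_left_in_cell.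
exists (j %/ 2 ^ (n - m))%N; first by rewrite ltn_divLR ?expn_gt0// -expnD subnKC.
have := subitvP (cantor_cell_le m (n - m) j) (cantor_left_in_cell _ _).
by rewrite subnK.
Qed.

Lemma near_infty_cantor_cell_dist e : 0 < e ->
  \forall n \near \oo, forall j t, t \in cantor_cell n j -> `|t - cantor_left n j| < e.
Proof.
have gamma01 : 0 <= gamma < 1 by rewrite ltW//; move: gamma_lt; lra.
move=> /(near_infty_expr_lt gamma01); apply: filterS => n gn_lt j t.
rewrite in_itv/= => /andP[jt tj].
by rewrite ger0_norm ?subr_ge0// ltrBlDl (le_lt_trans tj)// ltrD2l.
Qed.

Lemma cantor_set_sub12 : cantor_set gamma `<=` `[1, 2].
Proof. by move=> t /cantor_setP /(_ 0%N)[j /cantor_cell_le12/subitvP]; exact. Qed.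

Lemma cantor_set_compact : compact (cantor_set gamma).
Proof.
apply: (subclosed_compact _ (@segment_compact R 1 2) cantor_set_sub12).
apply: closed_bigI => n _; rewrite cantor_stageE; apply: closed_bigcup => //.
by move=> j _; exact: interval_closed.
Qed.

End cantor_cells.

Section cantor_function_on_cells.
Context {R : realType}.
Variable gamma : R.
Hypotheses (gamma_gt0 : 0 < gamma) (gamma_lt : gamma < 1 / 2).

Local Notation left := (cantor_left gamma).
Local Notation cell := (cantor_cell gamma).
Local Notation f := (cantor_function gamma).

Let gammaX_gt0 n : 0 < gamma ^+ n. Proof. by rewrite exprn_gt0. Qed.

Lemma cantor_approxS n j t : (j < 2 ^ n)%N -> t \in cell n j ->
  cantor_approx gamma n.+1 t =
  cantor_refine (gamma ^+ n.+1) (cantor_approx gamma n) (left n j, left n j + gamma ^+ n) t.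
Proof.
move=> jn tj /=; set s := [seq J <- _ | _].
have sP J : J \in s -> J = (left n j, left n j + gamma ^+ n).
  rewrite mem_filter => /andP[tJ /mem_cantor_intervals[i _ iJ]].
  by rewrite iJ in tJ *; rewrite (cantor_cell_inj gamma_gt0 gamma_lt tj tJ).
have : (left n j, left n j + gamma ^+ n) \in s.
  by rewrite mem_filter tj; apply/mem_cantor_intervals; exists j.
by case: s sP => // J s /(_ J); rewrite inE eqxx => /(_ isT) ->.
Qed.

Lemma cantor_approxE n j t : (j < 2 ^ n)%N -> t \in cell n j ->
  cantor_approx gamma n t = (j%:R + (t - left n j) / gamma ^+ n) / 2 ^+ n.
Proof.
elim: n j t => [|n ih] j t jn tj.
  by move: jn; rewrite expn0 ltnS leqn0 => /eqP -> /=; rewrite mulr0 !expr0 !divr1; ring.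
have j2n : (j./2 < 2 ^ n)%N by rewrite ltn_half_exp2.
have tj2 := subitvP (cantor_cellS_le gamma_gt0 gamma_lt n j) tj.
have lj := cantor_left_in_cell gamma_gt0 n j./2.
have rj : left n j./2 + gamma ^+ n \in cell n j./2 by rewrite in_itv/= lexx lerDl ltW.
rewrite (cantor_approxS j2n tj2) /cantor_refine (ih _ _ j2n lj) (ih _ _ j2n rj).
have [g0 g_lt] := (gamma_gt0, gamma_lt); have gn := gammaX_gt0 n.
have [gN gnN e2] : [/\ gamma != 0, gamma ^+ n != 0 & (2 ^+ n : R) != 0].
  by rewrite !gt_eqF.
have -> : left n j./2 + gamma ^+ n - left n j./2 = gamma ^+ n by ring.
rewrite subrr mul0r addr0 divff// /affine_interp !exprS.
have jE : j%:R = (odd j)%:R + 2 * j./2%:R :> R.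
  by rewrite -{1}(odd_double_half j) natrD -muln2 natrM mulrC.
have sgn : 0 < (1 - 2 * gamma) * gamma ^+ n by rewrite mulr_gt0//; lra.
move: tj; rewrite in_itv/= exprS jE => /andP[]; case: (odd j) => /= t1 t2.
  rewrite ifF; last by apply/negbTE; rewrite -ltNge; lra.
  rewrite ifF; last by apply/negbTE; rewrite -leNgt; lra.
  field; rewrite e2 gnN gN /= (_ : _ - _ = gamma * gamma ^+ n) ?mulf_neq0//; ring.
rewrite ifT; last by lra.
field; rewrite e2 gnN gN /= (_ : _ - _ = gamma * gamma ^+ n) ?mulf_neq0//; ring.
Qed.

Lemma cantor_approx_left n j m : (n <= m)%N -> (j < 2 ^ n)%N ->
  cantor_approx gamma m (left n j) = j%:R / 2 ^+ n.
Proof.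
move=> /subnK <- jn; set k := (m - n)%N.
rewrite -(cantor_left_mulX2 gamma n j k) (@cantor_approxE _ (j * 2 ^ k)).
- by rewrite subrr mul0r addr0 natrM natrX exprD; field; rewrite !gt_eqF.
- by rewrite expnD mulnC ltn_pmul2l ?expn_gt0.
- exact: cantor_left_in_cell.
Qed.

Lemma cantor_function_left n j : (j < 2 ^ n)%N -> f (left n j) = j%:R / 2 ^+ n.
Proof.
move=> jn; have left12 := cantor_set_sub12 gamma_gt0 gamma_lt
  (cantor_left_in_cantor_set gamma_gt0 gamma_lt jn).
rewrite /= in_itv/= in left12; case/andP: left12 => left1 left2.
rewrite /cantor_function ltNge left1/= ltNge left2/=.
apply: norm_lim_near_cst; near=> m; apply: cantor_approx_left => //.
by near: m; exists n.
Unshelve. all: end_near. Qed.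

Lemma cantor_approx_itv n m j t : (n <= m)%N -> cantor_set gamma t -> t \in cell n j ->
  j%:R / 2 ^+ n <= cantor_approx gamma m t <= (j%:R + 1) / 2 ^+ n.
Proof.
move=> /subnK <-; set k := (m - n)%N => /(cantor_setP gamma_gt0 gamma_lt) /(_ (k + n)%N).
move=> [i ikn ti] tj; rewrite (cantor_approxE ikn ti).
have iE : (i %/ 2 ^ k)%N = j.
  exact: cantor_cell_inj (subitvP (cantor_cell_le gamma_gt0 gamma_lt n k i) ti) tj.
have : 0 <= (t - left (k + n) i) / gamma ^+ (k + n) <= 1.
  move: ti; rewrite in_itv/= => /andP[t1 t2].
  by rewrite divr_ge0 ?subr_ge0 ?(ltW (gammaX_gt0 _))//= ler_pdivrMr// mul1r lerBlDl.
move=> /andP[]; set e := _ / gamma ^+ _ => e0 e1.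
have := leq_trunc_div i (2 ^ k); have := ltn_ceil i (expn_gt0 2 k : (0 < 2 ^ k)%N).
rewrite iE -(ler_nat R) -(ler_nat R (j * _)) -natr1 !natrM natrX -natr1 => i2 i1.
rewrite exprD invfM mulrA !ler_pM2r ?invr_gt0// ler_pdivlMr// ler_pdivrMr//.
by apply/andP; split; lra.
Qed.

Lemma cantor_approx_cvg t : cantor_set gamma t -> cvgn (fun n => cantor_approx gamma n t).
Proof.
move=> Ct; apply: cauchy_cvg; apply: cauchy_exP => _/posnumP[e].
have half01 : 0 <= (2 : R)^-1 < 1 by lra.
have [n _ /(_ n (leqnn n)) half_lt] := near_infty_expr_lt half01 (gt0 e).
have [j _ tj] := (cantor_setP gamma_gt0 gamma_lt t).1 Ct n.
exists (cantor_approx gamma n t); exists n => //= m nm.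
have := cantor_approx_itv nm Ct tj; have := cantor_approx_itv (leqnn n) Ct tj.
rewrite mulrDl mul1r -exprVn => approx_n approx_m.
by apply: le_lt_trans half_lt; rewrite ler_norml; lra.
Qed.

Lemma cantor_function_itv n j t : cantor_set gamma t -> t \in cell n j ->
  j%:R / 2 ^+ n <= f t <= (j%:R + 1) / 2 ^+ n.
Proof.
move=> Ct tj; have := cantor_set_sub12 gamma_gt0 gamma_lt Ct; rewrite /= in_itv/= => /andP[t1 t2].
rewrite /cantor_function ltNge t1/= ltNge t2/=; have cvg_t := cantor_approx_cvg Ct.
apply/andP; split; [apply: limr_ge => //|apply: limr_le => //];
  near=> m; (have nm : (n <= m)%N by near: m; exists n);
  by case/andP: (cantor_approx_itv nm Ct tj).
Unshelve. all: end_near. Qed.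

Lemma cantor_function_continuous : {within cantor_set gamma, continuous f}.
Proof.
apply/subspace_continuousP => t Ct; apply/cvgrPdist_lt => e e0.
have half01 : 0 <= (2 : R)^-1 < 1 by lra.
have [n _ /(_ n (leqnn n)) half_lt] := near_infty_expr_lt half01 e0.
have gn := gammaX_gt0 n.
have sgn : 0 < (1 - 2 * gamma) * gamma ^+ n by rewrite mulr_gt0//; move: gamma_lt; lra.
near=> t'; have Ct' : cantor_set gamma t' by near: t'; exact: withinT.
have tt' : `|t - t'| < (1 - 2 * gamma) * gamma ^+ n.
  near: t'; apply: cvg_within; exact: nbhsx_ballx.
have [j _ tj] := (cantor_setP gamma_gt0 gamma_lt t).1 Ct n.
have [i _ ti] := (cantor_setP gamma_gt0 gamma_lt t').1 Ct' n.
have ij : i = j.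
  move: tt' tj ti; rewrite ltr_norml !in_itv/= => tt' tj ti.
  by case: (ltngtP i j) => // /(cantor_left_gap gamma_gt0 gamma_lt n) gap; exfalso; lra.
have := cantor_function_itv Ct tj; have := cantor_function_itv Ct' ti.
rewrite ij mulrDl mul1r -exprVn => f_t f_t'.
by apply: le_lt_trans half_lt; rewrite /from_subspace ler_norml; lra.
Unshelve. all: end_near. Qed.

End cantor_function_on_cells.

Section real_valued_probability.
Context {d : measure_display} {T : measurableType d} {R : realType}.
Variable P : probability T R.
Implicit Types (A : nat -> set T) (D E : set T).

Definition pr E : R := fine (P E).

Lemma prE E : measurable E -> P E = (pr E)%:E.
Proof. by move=> mE; rewrite /pr fineK// fin_num_measure. Qed.

Lemma pr_ge0 E : 0 <= pr E.
Proof. by rewrite /pr fine_ge0. Qed.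

Lemma pr_set0 : pr set0 = 0.
Proof. by rewrite /pr measure0. Qed.

Lemma le_pr D E : measurable D -> measurable E -> D `<=` E -> pr D <= pr E.
Proof. by move=> mD mE DE; rewrite -lee_fin -!prE// le_measure// inE. Qed.

Lemma pr_setU D E : measurable D -> measurable E ->
  pr (D `|` E) = pr D + pr E - pr (D `&` E).
Proof.
move=> mD mE; apply: EFin_inj; rewrite EFinB EFinD -!prE//.
- by apply: measureUfinr => //; rewrite ltey_eq fin_num_measure.
- exact: measurableI.
- exact: measurableU.
Qed.

Lemma pr_setU_le D E : measurable D -> measurable E -> pr (D `|` E) <= pr D + pr E.
Proof. by move=> mD mE; rewrite pr_setU// lerBlDr lerDl pr_ge0. Qed.

Lemma pr_bigsetU_le A n : (forall i, measurable (A i)) ->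
  pr (\big[setU/set0]_(i < n) A i) <= \sum_(i < n) pr (A i).
Proof.
move=> mA; rewrite -lee_fin -prE; last exact: bigsetU_measurable.
rewrite -sumEFin; under [leRHS]eq_bigr do rewrite -prE//.
exact: Boole_inequality.
Qed.

Lemma pr_bigsetU_seqDU A n E : (forall i, measurable (A i)) -> measurable E ->
  pr (\big[setU/set0]_(i < n) A i `&` E) = \sum_(i < n) pr (seqDU A i `&` E).
Proof.
move=> mA mE; have mI i : measurable (seqDU A i `&` E).
  by apply: measurableI => //; exact: seqDU_measurable.
apply: EFin_inj; rewrite -prE; last first.
  by apply: measurableI => //; exact: bigsetU_measurable.
rewrite -sumEFin; under [RHS]eq_bigr do rewrite -prE//.
rewrite bigsetU_seqDU big_distrl/=.
apply: (measure_bigsetU P (F := fun i => seqDU A i `&` E)) => //.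
by apply: trivIset_setIr; exact: trivIset_seqDU.
Qed.

Lemma bonferroni A n : (forall i, measurable (A i)) ->
  \sum_(j < n) pr (A j) - \sum_(j < n) \sum_(i < j) pr (A i `&` A j) <=
  pr (\big[setU/set0]_(j < n) A j).
Proof.
move=> mA; elim: n => [|n ih]; first by rewrite !big_ord0 subr0 pr_set0.
rewrite !big_ord_recr /= pr_setU//; last exact: bigsetU_measurable.
have := @pr_bigsetU_le (fun i => A i `&` A n) n (fun i => measurableI _ _ (mA i) (mA n)).
by rewrite -big_distrl/=; lra.
Qed.

Lemma pr_bigcup_le A c : (forall i, measurable (A i)) ->
  (forall n, \sum_(i < n) pr (A i) <= c) -> pr (\bigcup_n A n) <= c.
Proof.
move=> mA sum_le; have mU : measurable (\bigcup_n A n) by exact: bigcup_measurable.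
rewrite -lee_fin -prE//; apply: le_trans (generalized_Boole_inequality P mA mU) _.
apply: lime_le; first exact: is_cvg_nneseries.
apply: nearW => n; rewrite big_mkord (eq_bigr (fun i : 'I_n => (pr (A i))%:E)) => [|i _].
  by rewrite sumEFin lee_fin; exact: sum_le.
exact: prE.
Qed.

Lemma le_pr_bigcap A c : (forall i, measurable (A i)) -> nonincreasing_seq A ->
  (forall n, c <= pr (A n)) -> c <= pr (\bigcap_n A n).
Proof.
move=> mA niA c_le; have mI : measurable (\bigcap_n A n) by exact: bigcap_measurable.
have A0_fin : (P (A 0%N) < +oo)%E by rewrite prE// ltry.
have cvgA := nonincreasing_cvg_mu A0_fin mA mI niA.
rewrite -lee_fin -prE// -(cvg_lim _ cvgA)//; apply: lime_ge.
  by apply/cvg_ex; eexists; exact: cvgA.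
by apply: nearW => n /=; rewrite prE// lee_fin.
Qed.

Lemma independent_of_pi_system (G : set (set T)) D : G `<=` measurable -> setI_closed G ->
  G setT -> measurable D -> (forall E, G E -> P (E `&` D) = (P E * P D)%E) ->
  forall E, <<s G >> E -> P (E `&` D) = (P E * P D)%E.
Proof.
move=> mG GI GT mD indepG E GE.
have PD0 : 0 <= fine (P D) by exact: pr_ge0.
have scaleE F : mscale (NngNum PD0) P F = (P F * P D)%E.
  by rewrite /mscale/= fineK ?fin_num_measure// muleC.
rewrite -scaleE -[LHS]/(mrestr P mD E).
apply: (@g_sigma_algebra_measure_unique _ _ _ G mG (fun=> setT)) GE => //.
- exact: bigcup_const.
- by move=> F GF; exact: etrans (indepG F GF) (esym (scaleE F)).
- by move=> _; rewrite /= /mrestr setTI ltey_eq fin_num_measure.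
Qed.

End real_valued_probability.

Section increments.
Context {d : measure_display} {T : measurableType d} {R : realType}.
Variables (P : probability T R) (B : R -> {RV P >-> R}).
Implicit Types (s t u c e y z : R) (V W : set R).

Definition increment s t (w : T) : R := B t w - B s w.

Definition window s t c e : set T := [set w | `|increment s t w - c| <= e].

Definition big_increment s t y : set T := [set w | y < `|increment s t w|].

Lemma incrementD s t u w : increment s t w + increment t u w = increment s u w.
Proof. by rewrite /increment; ring. Qed.

Lemma measurable_increment s t V : measurable V -> measurable (increment s t @^-1` V).
Proof.
move=> mV; rewrite -[X in measurable X]setTI.
suff : measurable_fun setT (increment s t) by apply.
by apply: measurable_funB; exact: measurable_funP.
Qed.

Lemma windowE s t c e : window s t c e = increment s t @^-1` `[c - e, c + e].
Proof. by apply/seteqP; split=> w; rewrite /window /= in_itv/= ler_distl. Qed.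

Lemma measurable_window s t c e : measurable (window s t c e).
Proof. by rewrite windowE; exact: measurable_increment. Qed.

Lemma big_incrementE s t y :
  big_increment s t y = increment s t @^-1` (~` `[- y, y]%classic).
Proof.
by apply/seteqP; split=> w; rewrite /big_increment /= in_itv/= -ler_norml ltNge => /negP.
Qed.

Lemma measurable_big_increment s t y : measurable (big_increment s t y).
Proof. by rewrite big_incrementE; apply: measurable_increment; exact: measurableC. Qed.

Lemma window_trans s t u c e c' e' :
  window s t c e `&` window t u c' e' `<=` window s u (c + c') (e + e').
Proof.
move=> w [st tu]; rewrite /window /= -(incrementD s t u) opprD addrACA.
by apply: le_trans (ler_normD _ _) _; rewrite lerD.
Qed.

Lemma window_diff s t u c e c' e' :
  window s t c e `&` window s u c' e' `<=` window t u (c' - c) (e + e').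
Proof.
move=> w [st su]; rewrite /window /=.
rewrite (_ : _ - _ = (increment s u w - c') - (increment s t w - c)); last first.
  by rewrite -(incrementD s t u); ring.
by apply: le_trans (ler_normB _ _) _; rewrite addrC lerD.
Qed.

Hypothesis hB : standard_brownian_motion B.

Lemma prob_increment s t V : 0 <= s -> s < t -> measurable V ->
  P (increment s t @^-1` V) = normal_prob 0 (Num.sqrt (t - s)) V.
Proof. by move=> s0 st mV; rewrite (bm_normal_increments hB). Qed.

Lemma pr_window_le s t c e z : 0 <= s -> s < t -> 0 <= e ->
  (forall x, `|x - c| <= e -> z <= x ^+ 2) ->
  pr P (window s t c e) <= 2 * e / Num.sqrt (t - s) * expR (- z / ((t - s) *+ 2)).
Proof.
move=> s0 st e0 z_le; have ts0 : 0 < t - s by rewrite subr_gt0.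
rewrite -lee_fin -prE; last exact: measurable_window.
rewrite windowE prob_increment// -[in X in expR X](sqr_sqrtr (ltW ts0)).
rewrite (_ : 2 * e = c + e - (c - e)); last by ring.
apply: normal_prob_itv_le; rewrite ?sqrtr_gt0//; first lra.
by move=> x xce; rewrite subr0 z_le// ler_distl.
Qed.

Lemma pr_window_ge s t c e z : 0 <= s -> s < t -> 0 <= e ->
  (forall x, `|x - c| <= e -> x ^+ 2 <= z) ->
  2 * e / (3 * Num.sqrt (t - s)) * expR (- z / ((t - s) *+ 2)) <= pr P (window s t c e).
Proof.
move=> s0 st e0 le_z; have ts0 : 0 < t - s by rewrite subr_gt0.
rewrite -lee_fin -prE; last exact: measurable_window.
rewrite windowE prob_increment// -[in X in expR X](sqr_sqrtr (ltW ts0)).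
rewrite (_ : 2 * e = c + e - (c - e)); last by ring.
apply: normal_prob_itv_ge; rewrite ?sqrtr_gt0//; first lra.
by move=> x xce; rewrite subr0 le_z// ler_distl.
Qed.

Lemma pr_window_le_sqrt s t c e : 0 <= s -> s < t -> 0 <= e ->
  pr P (window s t c e) <= 2 * e / Num.sqrt (t - s).
Proof.
move=> s0 st e0; have := pr_window_le (z := 0) s0 st e0 (fun x _ => sqr_ge0 x).
by rewrite oppr0 mul0r expR0 mulr1.
Qed.

Lemma pr_window_le_gauss s t c e : 0 <= s -> s < t -> 0 <= e -> 2 * e <= c ->
  pr P (window s t c e) <= 2 * e / Num.sqrt (t - s) * expR (- (c ^+ 2 / (8 * (t - s)))).
Proof.
move=> s0 st e0 ec; have ts0 : 0 < t - s by rewrite subr_gt0.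
rewrite [X in expR X](_ : _ = - (c ^+ 2 / 4) / ((t - s) *+ 2)); last first.
  by field; rewrite gt_eqF.
by apply: pr_window_le => // x; rewrite ler_norml => xce; nra.
Qed.

(* The window lies within [2 z] of the origin, where the Gaussian density with standard
   deviation between [z / 2] and [z] is at least [expR (- 8) / (3 z)]. *)
Lemma pr_window_ge_scale s t c e z : 0 <= s -> 0 < z -> z ^+ 2 / 4 <= t - s <= z ^+ 2 ->
  0 <= c <= z -> 0 <= e <= z -> 2 * e / (3 * z) * expR (- 8) <= pr P (window s t c e).
Proof.
move=> s0 z0 /andP[ts1 ts2] /andP[c0 cz] /andP[e0 ez].
have z20 : 0 < z ^+ 2 by rewrite exprn_gt0.
have ts0 : 0 < t - s by lra.
have near_le x : `|x - c| <= e -> x ^+ 2 <= 4 * z ^+ 2.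
  by rewrite ler_norml => xce; have : 0 <= 2 * z - x /\ 0 <= 2 * z + x; [lra|nra].
apply: le_trans (pr_window_ge s0 _ e0 near_le); last by rewrite -subr_gt0.
have sqrt_gt0 : 0 < Num.sqrt (t - s) by rewrite sqrtr_gt0.
rewrite ler_pM ?expR_ge0//; first by rewrite divr_ge0 ?mulr_ge0// ltW.
  rewrite ler_wpM2l ?mulr_ge0// lef_pV2 ?posrE ?mulr_gt0// ler_pM2l//.
  by rewrite -[leRHS]gtr0_norm// -sqrtr_sqr ler_sqrt// ltW.
by rewrite ler_expR mulNr lerN2 ler_pdivrMr ?mulrn_wgt0//; lra.
Qed.

Lemma pr_big_increment_le s t y : 0 <= s -> s <= t -> 0 < y ->
  pr P (big_increment s t y) <= 128 * (t - s) ^+ 2 / y ^+ 4.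
Proof.
move=> s0; rewrite le_eqVlt => /orP[/eqP <- y0|st y0].
  rewrite (_ : big_increment s s y = set0).
    by rewrite pr_set0 subrr expr0n mulr0 mul0r.
  by apply/seteqP; split=> w //=; rewrite /big_increment /increment/= subrr normr0 ltNge ltW.
have ts0 : 0 < t - s by rewrite subr_gt0.
rewrite -lee_fin -prE; last exact: measurable_big_increment.
rewrite big_incrementE prob_increment//; last exact: measurableC.
rewrite (_ : ~` _ = [set x : R | y < `|x - 0|]); last first.
  by apply/seteqP; split=> x; rewrite /= in_itv/= subr0 -ler_norml ltNge => /negP.
apply: le_trans (normal_prob_tail_inv4 0 _ y0) _; first by rewrite sqrtr_gt0.
by rewrite lee_fin expr_div_n (exprM _ 2 2) sqr_sqrtr ?(ltW ts0)// mulrA.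
Qed.

Section past_of_a_grid.
Variable a : nat -> R.
Hypotheses (a0_ge0 : 0 <= a 0%N) (a_nd : forall k, a k <= a k.+1).

Definition grid_cylinders n : set (set T) :=
  [set E | exists2 V : nat -> set R, (forall k, measurable (V k)) &
           E = \bigcap_(k in `I_n) (increment (a k) (a k.+1) @^-1` V k)].

Definition grid_past n : set (set T) := <<s grid_cylinders n >>.

Lemma measurable_grid_cylinders n : grid_cylinders n `<=` measurable.
Proof.
by move=> _ [V mV ->]; apply: bigcap_measurableType => k _; exact: measurable_increment.
Qed.

Lemma grid_past_measurable n E : grid_past n E -> measurable E.
Proof.
move: E; apply: smallest_sub; first exact: sigma_algebra_measurable.
exact: measurable_grid_cylinders.
Qed.

Lemma prob_grid_cylinder_increment n t (V : nat -> set R) W : a n <= t ->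
  (forall k, measurable (V k)) -> measurable W ->
  P (\bigcap_(k in `I_n) (increment (a k) (a k.+1) @^-1` V k) `&` increment (a n) t @^-1` W) =
  (\prod_(k < n) P (increment (a k) (a k.+1) @^-1` V k) * P (increment (a n) t @^-1` W))%E.
Proof.
move=> ant mV mW.
pose tau k := if (k <= n)%N then a k else t.
pose U k := if (k < n)%N then V k else W.
have tau_nd k : tau k <= tau k.+1 by rewrite /tau; case: (ltngtP k n) => // ->.
have mU k : measurable (U k) by rewrite /U; case: ifP.
have past_incr k : (k < n)%N ->
    increment (tau k) (tau k.+1) @^-1` U k = increment (a k) (a k.+1) @^-1` V k.
  by move=> kn; rewrite /tau /U kn ltnW.
have last_incr : increment (tau n) (tau n.+1) @^-1` U n = increment (a n) t @^-1` W.
  by rewrite /tau /U leqnn ltnn.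
have := @bm_independent_increments _ _ _ _ _ hB n.+1 tau a0_ge0 tau_nd
  (fun i : 'I_n.+1 => U i) (fun i => mU i).
rewrite big_ord_recr /= -/(increment _ _) last_incr.
under [X in _ = (X * _)%E -> _]eq_bigr => k _ do rewrite -/(increment _ _) past_incr//.
move=> <-; congr (P _); apply/seteqP; split=> w.
  move=> [cyl_w last_w] [k /=]; rewrite ltnS leq_eqVlt => /orP[/eqP -> _|kn _].
    by rewrite -last_incr in last_w.
  by have := cyl_w k kn; rewrite -past_incr.
move=> inc_w; split=> [k kn|]; last by rewrite -last_incr; exact: (inc_w ord_max I).
by rewrite -past_incr//; exact: (inc_w (Ordinal (ltnW kn : (k < n.+1)%N)) I).
Qed.

Lemma grid_past_independent n t W E : a n <= t -> measurable W -> grid_past n E ->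
  pr P (E `&` increment (a n) t @^-1` W) = pr P E * pr P (increment (a n) t @^-1` W).
Proof.
move=> ant mW pastE; have mI := measurable_increment (a n) t mW.
have mE := grid_past_measurable pastE.
suff indepE : P (E `&` increment (a n) t @^-1` W) = (P E * P (increment (a n) t @^-1` W))%E.
  by rewrite /pr indepE fineM ?fin_num_measure.
apply: independent_of_pi_system (measurable_grid_cylinders (n := n)) _ _ mI _ _ pastE.
- move=> _ _ [V mV ->] [V' mV' ->]; exists (fun k => V k `&` V' k).
    by move=> k; exact: measurableI.
  by rewrite -bigcapI; apply: eq_bigcapr => k _; rewrite preimage_setI.
- by exists (fun=> setT) => //; apply/seteqP; split.
move=> _ [V mV ->]; rewrite prob_grid_cylinder_increment//; congr (_ * _)%E.
have := prob_grid_cylinder_increment (lexx (a n)) mV measurableT.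
by rewrite preimage_setT setIT probability_setT mule1.
Qed.

Lemma grid_past_window n k c e : (k <= n)%N -> grid_past n (window (a 0%N) (a k) c e).
Proof.
move=> kn; pose U := g_sigma_algebraType (grid_cylinders n).
have mstep l : (l < n)%N -> measurable_fun (setT : set U) (increment (a l) (a l.+1)).
  move=> ln _ V mV; rewrite setTI; apply: sub_gen_smallest.
  exists (fun j => if j == l then V else setT) => [j|]; first by case: eqP.
  apply/seteqP; split=> w; first by move=> Vw j /= _; case: eqP => // ->.
  by move=> /(_ l ln); rewrite /= eqxx.
have mincr : measurable_fun (setT : set U) (increment (a 0%N) (a k)).
  elim: k kn => [_|k ih kn].
    by rewrite (_ : increment _ _ = cst 0)//; apply/funext => w; rewrite /increment subrr.
  rewrite (_ : increment _ _ = increment (a 0%N) (a k) \+ increment (a k) (a k.+1)).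
    by apply: measurable_funD; [exact: ih (ltnW kn)|exact: mstep].
  by apply/funext => w; rewrite /= incrementD.
by rewrite windowE -[X in grid_past n X]setTI; exact: mincr.
Qed.

Lemma grid_past_seqDU n (A : nat -> set T) i :
  (forall k, (k <= i)%N -> grid_past n (A k)) -> grid_past n (seqDU A i).
Proof.
move=> pastA; pose U := g_sigma_algebraType (grid_cylinders n).
rewrite -[grid_past n _]/(@measurable _ U _); apply: measurableD; first exact: pastA.
by rewrite -bigcup_mkord; apply: bigcup_measurable => k /= /ltnW; exact: pastA.
Qed.

End past_of_a_grid.

Lemma pr_consecutive_windows s t c e c' e' : 0 <= s -> s <= t ->
  pr P (window 0 s c e `&` window s t c' e') = pr P (window 0 s c e) * pr P (window s t c' e').
Proof.
move=> s0 st; pose a k : R := if k is 0%N then 0 else s.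
have a_nd k : a k <= a k.+1 by case: k.
rewrite [X in pr P (_ `&` X)]windowE [X in _ = _ * pr P X]windowE.
apply: (grid_past_independent (a := a) (lexx 0) a_nd (n := 1)) => //.
exact: (grid_past_window (a := a) (k := 1)).
Qed.

End increments.

Lemma compact_continuous_zero (R : realType) (X : topologicalType) (K : set X) (h : X -> R) :
  compact K -> {within K, continuous h} ->
  (forall e, 0 < e -> exists2 x, K x & `|h x| <= e) -> exists2 x, K x & h x = 0.
Proof.
move=> cK ch approx; have := compact_closed (@Rhausdorff R) (continuous_compact ch cK).
apply => V /nbhs_ballP[e /= e0 eV].
have [x Kx hx] := approx (e / 2) (divr_gt0 e0 (ltr0n _ 2)).
exists (h x); split; first by exists x.
by apply: eV; rewrite -ball_normE /= sub0r normrN; apply: le_lt_trans hx _; lra.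
Qed.

Section hitting_event.
Context {d : measure_display} {T : measurableType d} {R : realType}.
Variables (P : probability T R) (B : R -> {RV P >-> R}).
Variable gamma : R.

Local Notation left := (cantor_left gamma).
Local Notation f := (cantor_function gamma).

Definition hit : set T := [set w | zeros (fun t => B t w - f t) `&` cantor_set gamma !=set0].

Definition level_window n (e : R) (j : nat) : set T := window B 0 (left n j) (j%:R / 2 ^+ n) e.

Definition jump_window n (e : R) (i j : nat) : set T :=
  window B (left n i) (left n j) ((j%:R - i%:R) / 2 ^+ n) e.

Definition level_hit n (e : R) : set T := \bigcup_(j < 2 ^ n) level_window n e j.

Definition near_hit (e : R) : set T := \bigcup_n level_hit n e.

Lemma measurable_level_window n e j : measurable (level_window n e j).
Proof. exact: measurable_window. Qed.

Lemma measurable_jump_window n e i j : measurable (jump_window n e i j).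
Proof. exact: measurable_window. Qed.

Lemma measurable_level_hit n e : measurable (level_hit n e).
Proof. by apply: bigcup_measurable => j _; exact: measurable_level_window. Qed.

Lemma measurable_near_hit e : measurable (near_hit e).
Proof. by apply: bigcup_measurable => n _; exact: measurable_level_hit. Qed.

Hypothesis hB : standard_brownian_motion B.
Hypotheses (gamma_gt0 : 0 < gamma) (gamma_lt : gamma < 1 / 2).

Lemma near_hitP e w : near_hit e w <->
  exists n, exists2 j, (j < 2 ^ n)%N & `|B (left n j) w - f (left n j)| <= e.
Proof.
split=> [[n _ [j /= jn wj]]|[n [j jn wj]]].
  exists n, j => //; rewrite cantor_function_left//; move: wj.
  by rewrite /level_window /window /increment /= (bm_start hB) subr0.
exists n => //; exists j => //; rewrite cantor_function_left// in wj.
by rewrite /level_window /window /increment /= (bm_start hB) subr0.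
Qed.

Lemma path_sub_cantor_function_continuous w :
  {within cantor_set gamma, continuous (fun t : R => (B t w : R) - f t)}.
Proof.
have path_cont : {within cantor_set gamma, continuous (fun t : R => B t w : R)}.
  apply: continuous_subspaceW (@bm_continuous_paths _ _ _ _ _ hB w) => t Ct.
  have := cantor_set_sub12 gamma_gt0 gamma_lt Ct.
  by rewrite /= !in_itv/= andbT => /andP[t1 _]; apply: le_trans t1.
by move=> t; apply: cvgB; [exact: path_cont|exact: cantor_function_continuous].
Qed.

Lemma hitE : hit = \bigcap_m near_hit m.+1%:R^-1.
Proof.
apply/seteqP; split=> w.
  move=> [t [[t0 Bt] Ct] m _]; apply/near_hitP.
  have /subspace_continuousP /(_ t Ct) := @path_sub_cantor_function_continuous w.
  move=> /cvgrPdist_le /(_ m.+1%:R^-1); rewrite invr_gt0 ltr0Sn => /(_ isT).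
  move=> /nbhs_ballP[del /= del0 near_t].
  have [n _ /(_ n (leqnn n)) cell_lt] := near_infty_cantor_cell_dist gamma_gt0 gamma_lt del0.
  have [j jn /cell_lt tj] := (cantor_setP gamma_gt0 gamma_lt t).1 Ct n.
  have Cj := cantor_left_in_cantor_set gamma_gt0 gamma_lt jn.
  exists n, j => //; have := near_t (left n j) tj Cj.
  by rewrite /from_subspace Bt sub0r normrN.
move=> near_w.
have [|t Ct Bt] := compact_continuous_zero (cantor_set_compact gamma_gt0 gamma_lt)
    (@path_sub_cantor_function_continuous w).
  move=> e e0; have [m _ /(_ m (leqnn m)) me] := near_infty_natSinv_lt (PosNum e0).
  have /near_hitP[n [j jn wj]] := near_w m I; exists (left n j).
    exact: cantor_left_in_cantor_set.
  by rewrite (le_trans wj)// ltW.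
exists t; split=> //; split=> //.
have := cantor_set_sub12 gamma_gt0 gamma_lt Ct; rewrite /= in_itv/= => /andP[t1 _].
exact: lt_le_trans t1.
Qed.

Lemma measurable_hit : measurable hit.
Proof. by rewrite hitE; apply: bigcap_measurable => // m _; exact: measurable_near_hit. Qed.

Lemma le_pr_hit c (e : nat -> R) : e n @[n --> \oo] --> 0 ->
  (forall n, c <= pr P (level_hit n (e n))) -> c <= pr P hit.
Proof.
move=> e_cvg c_le; rewrite hitE; apply: le_pr_bigcap => [m|m n mn|m].
- exact: measurable_near_hit.
- apply/subsetPset => w [k _ [j jk wj]]; exists k => //; exists j => //.
  by apply: (le_trans wj); rewrite lef_pV2 ?posrE// ler_nat.
have m0 : 0 < m.+1%:R^-1 :> R by rewrite invr_gt0.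
have [n _ /(_ n (leqnn n)) /= en] := cvgr_lt 0 e_cvg _ m0.
apply: le_trans (c_le n) _; apply: le_pr.
- exact: measurable_level_hit.
- exact: measurable_near_hit.
move=> w [j /= jn wj]; exists n => //; exists j => //.
exact: le_trans wj (ltW en).
Qed.

Lemma pr_level_window_le n e j : 0 <= e -> pr P (level_window n e j) <= 2 * e.
Proof.
move=> e0; have left1 := cantor_left_ge1 gamma_gt0 gamma_lt n j.
have left0 : 0 < left n j by apply: lt_le_trans left1.
apply: le_trans (pr_window_le_sqrt hB _ (lexx 0) left0 e0) _.
by rewrite subr0 ler_piMr ?mulr_ge0// invf_le1 ?sqrtr_gt0// -sqrtr1 ler_sqrt// ltW.
Qed.

Lemma pr_level_window_ge n e j : (j < 2 ^ n)%N -> 0 <= e <= 1 ->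
  e / 3 * expR (- 8) <= pr P (level_window n e j).
Proof.
move=> jn /andP[e0 e1]; have left1 := cantor_left_ge1 gamma_gt0 gamma_lt n j.
have left2 : left n j <= 2.
  have := subitvP (cantor_cell_le12 gamma_gt0 gamma_lt jn) (cantor_left_in_cell gamma_gt0 n j).
  by rewrite in_itv/= => /andP[].
have jn1 : j%:R / 2 ^+ n <= 1 :> R.
  by rewrite ler_pdivrMr ?exprn_gt0// mul1r -natrX ler_nat ltnW.
have jn0 : 0 <= j%:R / 2 ^+ n :> R by rewrite divr_ge0 ?exprn_ge0.
rewrite (_ : e / 3 = 2 * e / (3 * 2)); last by field.
by apply: (pr_window_ge_scale hB (z := 2)); rewrite ?subr0; lra.
Qed.

Lemma level_window_diff n e e' i j :
  level_window n e i `&` level_window n e' j `<=` jump_window n (e + e') i j.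
Proof. by rewrite /jump_window mulrBl; exact: window_diff. Qed.

Lemma level_window_jump n e e' i j :
  level_window n e i `&` jump_window n e' i j `<=` level_window n (e + e') j.
Proof. by move=> w /window_trans; rewrite mulrBl subrKC. Qed.

Lemma sum_first_hits_le n e e' j : 0 <= e -> 0 <= e' ->
  \sum_(i < j) pr P (seqDU (level_window n e) i) * pr P (jump_window n e' i j) <=
  2 * (e + e').
Proof.
move=> e0 e'0; have mW := measurable_level_window n e.
pose times k : R := if k is l.+1 then left n l else 0.
have times_nd k : times k <= times k.+1.
  by case: k => [|k] /=; [exact: cantor_left_ge0|apply: cantor_left_le].
apply: le_trans (pr_level_window_le n j (addr_ge0 e0 e'0)).
have mU : measurable (\big[setU/set0]_(i < j) level_window n e i).
  exact: bigsetU_measurable.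
apply: (@le_trans _ _ (pr P (\big[setU/set0]_(i < j) level_window n e i `&`
                             level_window n (e + e') j))); last first.
  by apply: le_pr => //; [apply: measurableI => //|]; exact: measurable_level_window.
rewrite pr_bigsetU_seqDU//; last exact: measurable_level_window.
apply: ler_sum => i _; rewrite /jump_window windowE.
rewrite -(grid_past_independent hB (a := times) (lexx 0) times_nd (n := i.+1))//; last 2 first.
- exact: cantor_left_le (ltnW (ltn_ord i)).
- by apply: grid_past_seqDU => k ki; apply: (grid_past_window (a := times) (k := k.+1)).
rewrite -windowE; apply: le_pr.
- by apply: measurableI; [exact: seqDU_measurable|exact: measurable_jump_window].
- by apply: measurableI; [exact: seqDU_measurable|exact: measurable_level_window].
move=> w [first_w jump_w]; split=> //.
by apply: level_window_jump; split; [exact: subset_seqDU first_w|exact: jump_w].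
Qed.

End hitting_event.

Section second_moment.
Context {d : measure_display} {T : measurableType d} {R : realType}.
Variables (P : probability T R) (B : R -> {RV P >-> R}).
Hypothesis hB : standard_brownian_motion B.
Variable gamma : R.
Hypotheses (gamma_gt0 : 0 < gamma) (gamma_lt : gamma < 1 / 2).

Local Notation left := (cantor_left gamma).
Local Notation hits := (level_window B gamma).

Definition joint_pr n (e : R) (i j : nat) : R := pr P (hits n e i `&` hits n e j).

Let gammaX_gt0 m : 0 < gamma ^+ m. Proof. by rewrite exprn_gt0. Qed.

Let exp2_gt0 m : 0 < (2 : R) ^+ m. Proof. by rewrite exprn_gt0. Qed.

Let sub2gamma_gt0 : 0 < 1 - 2 * gamma. Proof. by move: gamma_lt; lra. Qed.

Lemma joint_pr_le n e i j : (i < j)%N -> 0 <= e -> 4 * e <= 2 ^- n ->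
  joint_pr n e i j <=
  8 * e ^+ 2 / Num.sqrt (left n j - left n i) *
  expR (- (((j%:R - i%:R) / 2 ^+ n) ^+ 2 / (8 * (left n j - left n i)))).
Proof.
move=> ij e0 e_le; have lefti0 := cantor_left_ge0 gamma_gt0 gamma_lt n i.
have left_lt : left n i < left n j.
  rewrite -subr_gt0; apply: lt_le_trans (cantor_left_gap gamma_gt0 gamma_lt n ij).
  by rewrite mulr_gt0//; move: gamma_lt; lra.
set jump := (j%:R - i%:R) / 2 ^+ n.
have jump_ge : 2 ^- n <= jump.
  rewrite -[leLHS]mul1r ler_pM2r ?invr_gt0//.
  by have : i%:R + 1 <= j%:R :> R; [rewrite natr1 ler_nat|lra].
set tau := left n j - left n i; set gauss := expR _.
rewrite (_ : _ * gauss = 2 * e * (2 * (e + e) / Num.sqrt tau * gauss)); last by ring.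
apply: (@le_trans _ _ (pr P (hits n e i `&` jump_window B gamma n (e + e) i j))).
  apply: le_pr => [| |w both].
  - by apply: measurableI; exact: measurable_level_window.
  - by apply: measurableI; [exact: measurable_level_window|exact: measurable_jump_window].
  - by split; [case: both|exact: level_window_diff both].
rewrite /jump_window -/jump (pr_consecutive_windows hB _ _ _ _ lefti0 (ltW left_lt)).
rewrite ler_pM ?pr_ge0//.
  exact: (pr_level_window_le hB gamma_gt0 gamma_lt).
by apply: (pr_window_le_gauss hB lefti0 left_lt); lra.
Qed.

Lemma split_sum_joint_pr_le n m l q e : (l + m.+1 = n)%N -> 0 <= e -> 4 * e <= 2 ^- n ->
  split_sum (joint_pr n e) l q <=
  8 * e ^+ 2 / Num.sqrt ((1 - 2 * gamma) * gamma ^+ m) *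
  \sum_(x < 2 ^ l) \sum_(y < 2 ^ l)
     expR (- ((2 ^ l + x - y)%:R ^+ 2 * (8 * (2 ^+ n) ^+ 2 * gamma ^+ m)^-1)).
Proof.
move=> lmn e0 e_le; rewrite mulr_sumr; apply: ler_sum => x _.
rewrite mulr_sumr; apply: ler_sum => y _.
set i := (q.*2 * _ + y)%N; set j := (q.*2.+1 * _ + x)%N.
have xl := ltn_ord x; have yl := ltn_ord y.
have block k z : (z < 2 ^ l -> (k * 2 ^ l + z) %/ 2 ^ l = k)%N.
  by move=> zl; rewrite divnMDl ?expn_gt0// divn_small// addn0.
have ij : (i < j)%N by rewrite /i /j mulSn; lia.
have -> : (2 ^ l + x - y = j - i)%N by rewrite /i /j mulSn; lia.
have := cantor_left_split gamma_gt0 gamma_lt m (block q.*2 _ yl) (block q.*2.+1 _ xl).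
rewrite lmn -/i -/j => /andP[tau_ge tau_le].
have tau_lo : 0 < (1 - 2 * gamma) * gamma ^+ m by rewrite mulr_gt0.
have tau_gt0 : 0 < left n j - left n i by apply: lt_le_trans tau_ge.
apply: le_trans (joint_pr_le ij e0 e_le) _.
rewrite ler_pM ?expR_ge0 ?divr_ge0 ?sqrtr_ge0 ?mulr_ge0 ?sqr_ge0//.
  rewrite ler_wpM2l ?mulr_ge0 ?sqr_ge0// lef_pV2 ?posrE ?sqrtr_gt0//.
  by rewrite ler_sqrt// ltW.
set tau := left n j - left n i in tau_ge tau_le tau_gt0 *.
rewrite ler_expR lerN2 natrB ?(ltnW ij)//.
rewrite [leRHS](_ : _ = (j%:R - i%:R) ^+ 2 / (8 * (2 ^+ n) ^+ 2 * tau)); last first.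
  by field; rewrite !gt_eqF.
rewrite ler_wpM2l ?sqr_ge0// lef_pV2 ?posrE ?mulr_gt0 ?exprn_gt0//.
by rewrite ler_pM2l ?mulr_gt0 ?exprn_gt0.
Qed.

Definition separation_ratio : R := Num.min (2 * Num.sqrt gamma) (2 * Num.sqrt gamma)^-1.

Lemma separation_ratio_itv : gamma != 1 / 4 -> 0 <= separation_ratio < 1.
Proof.
move=> gamma_neq; have s0 : 0 < 2 * Num.sqrt gamma by rewrite mulr_gt0 ?sqrtr_gt0.
have s2 : (2 * Num.sqrt gamma) ^+ 2 = 4 * gamma.
  by rewrite exprMn sqr_sqrtr ?(ltW gamma_gt0)//; ring.
rewrite le_min (ltW s0) invr_ge0 (ltW s0)/= gt_min invf_lt1//.
have [gamma_lt4|gamma_gt4|/eqP gammaE] := ltgtP gamma (1 / 4).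
- by apply/orP; left; move: s2 s0; nra.
- by apply/orP; right; move: s2 s0; nra.
- by rewrite gammaE in gamma_neq.
Qed.

Lemma split_sum_joint_pr_le_ratio n m l q eps : (l + m.+1 = n)%N -> 0 <= eps <= 1 / 4 ->
  split_sum (joint_pr n (eps / 2 ^+ n)) l q <=
  128 * eps ^+ 2 / Num.sqrt (1 - 2 * gamma) * (separation_ratio / 2) ^+ m.
Proof.
move=> lmn /andP[eps0 eps1].
have e0 : 0 <= eps / 2 ^+ n by rewrite divr_ge0// ltW.
have e_le : 4 * (eps / 2 ^+ n) <= 2 ^- n.
  by rewrite mulrA ler_piMl ?invr_ge0 ?(ltW (exp2_gt0 n))//; lra.
have s0 : 0 < Num.sqrt gamma by rewrite sqrtr_gt0.
have b0 : 0 < Num.sqrt (1 - 2 * gamma) by rewrite sqrtr_gt0.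
have sm0 : 0 < Num.sqrt gamma ^+ m by rewrite exprn_gt0.
have gammaE : gamma ^+ m = (Num.sqrt gamma ^+ m) ^+ 2 by rewrite exprAC sqr_sqrtr// ltW.
have [pl pm] := (exp2_gt0 l, exp2_gt0 m).
have nE : (2 : R) ^+ n = 2 ^+ l * (2 * 2 ^+ m) by rewrite -exprS -exprD lmn.
apply: le_trans (split_sum_joint_pr_le q lmn e0 e_le) _.
rewrite gammaE sqrtrM ?(ltW sub2gamma_gt0)// sqrtr_sqr (gtr0_norm sm0) -gammaE.
set C := 8 * _ / _; have C0 : 0 <= C by rewrite divr_ge0 ?mulr_ge0 ?sqr_ge0// ltW.
set c := (8 * _ * _)^-1; have c0 : 0 < c by rewrite invr_gt0 !mulr_gt0.
rewrite /separation_ratio; case: (leP (2 * Num.sqrt gamma)) => _.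
  apply: le_trans (ler_wpM2l C0 (sum_gauss_square_le _ c0)) _.
  rewrite [X in (X / 2) ^+ _]mulrC mulfK// /C /c invrK gammaE.
  by apply: eq_ler; field; rewrite !gt_eqF.
apply: le_trans (ler_wpM2l C0 (sum_gauss_square_le_card _ (ltW c0))) _.
rewrite expr_div_n exprVn exprMn /C natrX nE.
rewrite [leLHS](_ : _ = 2 * (eps ^+ 2 / Num.sqrt (1 - 2 * gamma) /
  (Num.sqrt gamma ^+ m * (2 ^+ m) ^+ 2))); last by field; rewrite !gt_eqF.
rewrite [leRHS](_ : _ = 128 * (eps ^+ 2 / Num.sqrt (1 - 2 * gamma) /
  (Num.sqrt gamma ^+ m * (2 ^+ m) ^+ 2))); last by field; rewrite !gt_eqF.
by rewrite ler_wpM2r ?ler_nat// !divr_ge0 ?sqr_ge0 ?mulr_ge0// ltW.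
Qed.

Lemma sum_joint_pr_le n eps : gamma != 1 / 4 -> 0 <= eps <= 1 / 4 ->
  \sum_(j < 2 ^ n) \sum_(i < j) joint_pr n (eps / 2 ^+ n) i j <=
  128 * eps ^+ 2 / Num.sqrt (1 - 2 * gamma) * (1 - separation_ratio)^-1.
Proof.
move=> gamma_neq heps; have ratio01 := separation_ratio_itv gamma_neq.
set C := 128 * _ / _; have C0 : 0 <= C by rewrite divr_ge0 ?sqrtr_ge0// mulr_ge0 ?sqr_ge0.
rewrite sum_pairs_split_sum.
apply: (@le_trans _ _ (\sum_(m < n) C * separation_ratio ^+ m)); last first.
  by rewrite -mulr_sumr ler_wpM2l// sum_expr_le.
apply: ler_sum => m _.
apply: (@le_trans _ _ (\sum_(q < 2 ^ m) C * (separation_ratio / 2) ^+ m)).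
  by apply: ler_sum => q _; apply: split_sum_joint_pr_le_ratio => //; rewrite subnK.
by rewrite sumr_const card_ord -[leLHS]mulr_natr natrX -mulrA -exprMn divfK.
Qed.

Lemma pr_level_hit_ge n eps : gamma != 1 / 4 -> 0 <= eps <= 1 / 4 ->
  eps / 3 * expR (- 8) -
  128 * eps ^+ 2 / Num.sqrt (1 - 2 * gamma) * (1 - separation_ratio)^-1 <=
  pr P (level_hit B gamma n (eps / 2 ^+ n)).
Proof.
move=> gamma_neq heps; rewrite /level_hit bigcup_mkord.
apply: le_trans (bonferroni P _ (measurable_level_window B gamma n (eps / 2 ^+ n))).
rewrite lerB ?sum_joint_pr_le//.
rewrite (_ : eps / 3 * _ = \sum_(j < 2 ^ n) eps / 2 ^+ n / 3 * expR (- 8)); last first.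
  by rewrite sumr_const card_ord -[RHS]mulr_natr natrX; field; rewrite gt_eqF.
apply: ler_sum => j _; apply: (pr_level_window_ge hB gamma_gt0 gamma_lt) => //.
case/andP: heps => eps0 eps1; rewrite divr_ge0 ?(ltW (exp2_gt0 n))//=.
by rewrite ler_pdivrMr// mul1r; have := exprn_ege1 n (ler1n R 2); lra.
Qed.

Lemma pr_hit_gt0 : gamma != 1 / 4 -> 0 < pr P (hit B gamma).
Proof.
move=> gamma_neq; have /andP[_ ratio1] := separation_ratio_itv gamma_neq.
pose c : R := expR (- 8) / 3.
pose K := 128 / Num.sqrt (1 - 2 * gamma) / (1 - separation_ratio).
have c0 : 0 < c by rewrite divr_gt0 ?expR_gt0.
have K0 : 0 < K by rewrite !divr_gt0 ?sqrtr_gt0// subr_gt0.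
pose eps := Num.min (1 / 4) (c / (2 * K)).
have eps0 : 0 < eps by rewrite lt_min !divr_gt0// mulr_gt0.
have eps1 : eps <= 1 / 4 by rewrite ge_min lexx.
have K20 : 0 < 2 * K by rewrite mulr_gt0.
have epsK : eps * (2 * K) <= c by rewrite -(ler_pdivlMr _ _ K20) ge_min lexx orbT.
apply: (@lt_le_trans _ _ (c * eps / 2)); first by rewrite divr_gt0// mulr_gt0.
apply: (le_pr_hit hB gamma_gt0 gamma_lt (e := fun n => eps / 2 ^+ n)) => [|n].
  rewrite -[X in _ --> X](mulr0 eps); apply: cvgMr.
  under eq_fun do rewrite -exprVn.
  by apply: cvg_expr; rewrite ger0_norm// invf_lt1// ltr1n.
have eps01 : 0 <= eps <= 1 / 4 by rewrite (ltW eps0).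
apply: le_trans (pr_level_hit_ge n gamma_neq eps01).
rewrite [leRHS](_ : _ = c * eps - K * eps ^+ 2); last by rewrite /c /K; ring.
by nra.
Qed.

End second_moment.

Section chaining.
Context {d : measure_display} {T : measurableType d} {R : realType}.
Variables (P : probability T R) (B : R -> {RV P >-> R}).
Variable gamma : R.
Implicit Types (y : nat -> R) (Y : R).

Local Notation left := (cantor_left gamma).
Local Notation cell := (cantor_cell gamma).

Definition oscillation n y : set T :=
  \bigcup_k \bigcup_(j < 2 ^ (k + n))
    big_increment B (left (k + n) j) (left (k + n).+1 j.*2.+1) (y k).

Lemma measurable_oscillation n y : measurable (oscillation n y).
Proof.
apply: bigcup_measurable => k _; apply: bigcup_measurable => j _.
exact: measurable_big_increment.
Qed.

Lemma chain_increment_le n y w k j : (forall l, 0 <= y l) -> ~ oscillation n y w ->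
  (j < 2 ^ (k + n))%N ->
  `|increment B (left n (j %/ 2 ^ k)) (left (k + n) j) w| <= \sum_(l < k) y l.
Proof.
move=> y0 calm; elim: k j => [|k ih] j jk.
  by rewrite divn1 /increment subrr normr0 big_ord0.
have j2k : (j./2 < 2 ^ (k + n))%N by rewrite ltn_half_exp2.
have last_step : `|increment B (left (k + n) j./2) (left (k + n).+1 j) w| <= y k.
  have := odd_double_half j; case: (odd j) => /= <-; last first.
    by rewrite add0n -/(left (k + n).+1 _) cantor_leftS_even doubleK /increment subrr normr0.
  rewrite leNgt; apply/negP => big_w; apply: calm; exists k => //.
  by exists j./2 => //; move: big_w; rewrite /big_increment /= uphalf_double.
rewrite big_ord_recr expnS divnMA divn2 addSn; apply: le_trans (lerD (ih _ j2k) last_step).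
by rewrite -(incrementD B _ (left (k + n) j./2)) ler_normD.
Qed.

Hypothesis hB : standard_brownian_motion B.
Hypotheses (gamma_gt0 : 0 < gamma) (gamma_lt : gamma < 1 / 2).

Lemma pr_oscillation_le n y c : (forall k, 0 < y k) ->
  (forall m, \sum_(k < m) 2 ^+ (k + n) * (128 * (gamma ^+ (k + n)) ^+ 2 / y k ^+ 4) <= c) ->
  pr P (oscillation n y) <= c.
Proof.
move=> y0 sum_le; apply: pr_bigcup_le => [k|m].
  by apply: bigcup_measurable => j _; exact: measurable_big_increment.
apply: le_trans (sum_le m); apply: ler_sum => k _.
have mA j := measurable_big_increment B (left (k + n) j) (left (k + n).+1 j.*2.+1) (y k).
rewrite bigcup_mkord; apply: le_trans (pr_bigsetU_le P _ mA) _.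
rewrite (_ : _ * _ =
  \sum_(j < 2 ^ (k + n)) 128 * (gamma ^+ (k + n)) ^+ 2 / y k ^+ 4); last first.
  by rewrite sumr_const card_ord -[RHS]mulr_natl natrX.
apply: ler_sum => j _; rewrite cantor_leftS_odd.
have g_gt0 : 0 < gamma ^+ (k + n) by rewrite exprn_gt0.
have [g0 g_lt] := (gamma_gt0, gamma_lt).
have step0 : 0 <= (1 - gamma) * gamma ^+ (k + n) by rewrite mulr_ge0 ?(ltW g_gt0)//; lra.
apply: le_trans (pr_big_increment_le hB _ _ (y0 k)) _; rewrite ?lerDl//.
  exact: (cantor_left_ge0 gamma_gt0 gamma_lt).
rewrite ler_wpM2r ?invr_ge0 ?exprn_ge0 ?(ltW (y0 _))// ler_wpM2l// addrAC subrr add0r.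
by rewrite ler_pXn2r ?nnegrE ?(ltW g_gt0)//; nra.
Qed.

Lemma cell_increment_le n y Y w i t : (forall l, 0 <= y l) ->
  (forall k, \sum_(l < k) y l <= Y) -> ~ oscillation n y w ->
  cantor_set gamma t -> t \in cell n i -> `|increment B (left n i) t w| <= Y.
Proof.
move=> y0 sum_le calm Ct ti; apply/ler_addgt0Pr => e e0.
have Ct_path : t \in `[0, +oo[.
  have := cantor_set_sub12 gamma_gt0 gamma_lt Ct.
  by rewrite /= !in_itv/= andbT => /andP[t1 _]; apply: le_trans t1.
have /subspace_continuousP /(_ t Ct_path) /cvgrPdist_le /(_ e e0) :=
  @bm_continuous_paths _ _ _ _ _ hB w.
move=> /nbhs_ballP[del /= del0 near_t].
have [k _ /(_ (k + n)%N (leq_addr _ _)) cell_lt] :=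
  near_infty_cantor_cell_dist gamma_gt0 gamma_lt del0.
have [j jk tj] := (cantor_setP gamma_gt0 gamma_lt t).1 Ct (k + n)%N.
have iE : (j %/ 2 ^ k)%N = i.
  apply: (cantor_cell_inj gamma_gt0 gamma_lt) _ ti.
  exact: subitvP (cantor_cell_le gamma_gt0 gamma_lt n k j) _ tj.
have left_path : left (k + n) j \in `[0, +oo[.
  by rewrite in_itv/= andbT (cantor_left_ge0 gamma_gt0 gamma_lt).
have Bt_le := near_t _ (cell_lt j t tj) left_path; rewrite /from_subspace in Bt_le.
have chain_le := chain_increment_le y0 calm jk; rewrite iE in chain_le.
apply: le_trans (lerD (le_trans chain_le (sum_le k)) Bt_le).
by rewrite -(incrementD B _ (left (k + n) j)) ler_normD.
Qed.

Lemma hit_sub_level_windows n y Y e : (forall l, 0 <= y l) ->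
  (forall k, \sum_(l < k) y l <= Y) -> Y + 2 ^- n <= e ->
  hit B gamma `<=` level_hit B gamma n e `|` oscillation n y.
Proof.
move=> y0 sum_le le_e w [t [[t0 /eqP]]]; rewrite subr_eq0 => /eqP Bt Ct.
have [rough|calm] := pselect (oscillation n y w); [by right|left].
have [i iN ti] := (cantor_setP gamma_gt0 gamma_lt t).1 Ct n.
exists i => //.
have := cell_increment_le y0 sum_le calm Ct ti.
have := cantor_function_itv gamma_gt0 gamma_lt Ct ti.
rewrite /level_window /window /increment /= (bm_start hB) subr0 mulrDl mul1r -Bt.
by move: (2 ^- n) (i%:R / 2 ^+ n) le_e => x z le_e f_t; rewrite !ler_norml; lra.
Qed.

End chaining.

Lemma divn_succ_dist b i j : (0 < b)%N -> (j %/ b = (i %/ b).+1)%N -> (i <= j <= 2 * b + i)%N.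
Proof.
move=> b0 jE; have := leq_trunc_div i b; have := ltn_ceil i b0.
have := leq_trunc_div j b; have := ltn_ceil j b0.
by rewrite jE !mulSn; lia.
Qed.

Lemma sum_ord_lt_exchange (V : nmodType) n (F : nat -> nat -> V) :
  \sum_(i < n) \sum_(j < n | (i < j)%N) F i j = \sum_(j < n) \sum_(i < j) F i j.
Proof.
rewrite (exchange_big_dep xpredT)//=; apply: eq_bigr => j _.
by rewrite (big_ord_widen n (F ^~ j) (ltnW (ltn_ord j))).
Qed.

(* Either [z >= k], and Markov's inequality applies, or [b ^ (k - z) >= 1]. *)
Lemma le_markov_or_bound (R : realFieldType) (x M b : R) z k :
  0 <= x <= M -> 1 <= b -> (0 < k)%N ->
  x <= z%:R * x / k%:R + M * b ^+ k * b^-1 ^+ z.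
Proof.
move=> /andP[x0 xM] b1 k0; have b0 : 0 < b by apply: lt_le_trans b1.
have M0 : 0 <= M by apply: le_trans xM.
have [kz|zk] := leqP k z.
  rewrite -[leLHS]addr0 lerD ?mulr_ge0 ?exprn_ge0 ?invr_ge0 ?(ltW b0)//.
  by rewrite ler_pdivlMr ?ltr0n// mulrC ler_wpM2r// ler_nat.
rewrite -[leLHS]add0r lerD ?divr_ge0 ?mulr_ge0// (le_trans xM)// -mulrA ler_peMr//.
by rewrite exprVn ler_pdivlMr ?exprn_gt0// mul1r ler_weXn2l// ltnW.
Qed.

Section quarter.
Context {d : measure_display} {T : measurableType d} {R : realType}.
Variables (P : probability T R) (B : R -> {RV P >-> R}).
Hypothesis hB : standard_brownian_motion B.

Local Notation gamma := (1 / 4 : R).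
Local Notation left := (cantor_left gamma).

(* The tolerance [4 ^- r] is the standard deviation of the increments of [B] over the cells
   of level [2 r]; the grid is [r] levels deeper, which makes the oscillations of [B] between
   its points negligible. *)
Local Notation depth r := (r.*2 + r)%N.
Local Notation tol r := (gamma ^+ r).
Local Notation first_hit r := (seqDU (level_window B gamma (depth r) (tol r))).

Let gamma_gt0 : 0 < gamma. Proof. by lra. Qed.

Let gamma_lt : gamma < 1 / 2. Proof. by lra. Qed.

Let tol_gt0 r : 0 < tol r. Proof. by rewrite exprn_gt0. Qed.

Let exp2_gt0 k : 0 < (2 : R) ^+ k. Proof. by rewrite exprn_gt0. Qed.

Let gammaXE k : gamma ^+ k = (2 ^+ k) ^- 2.
Proof. by rewrite expr_div_n expr1n -exprM -natrX mulnC expnM natrX mul1r. Qed.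

Let exp2_depth r : (2 : R) ^+ depth r = (2 ^+ r) ^+ 3.
Proof. by rewrite -exprM; congr (_ ^+ _); lia. Qed.

Lemma pr_jump_window_ge r i j l : (r <= l < depth r)%N ->
  ~~ odd (i %/ 2 ^ l) -> (j %/ 2 ^ l = (i %/ 2 ^ l).+1)%N ->
  expR (- 8) / 3 * 2 ^+ r / 2 ^+ l <= pr P (jump_window B gamma (depth r) (tol r) i j).
Proof.
move=> /andP[rl lr] i_even jE; set n := depth r in lr *; pose m := (n - l.+1)%N.
have lmn : (l + m.+1 = n)%N by rewrite addnS -addSn subnKC.
have iE : (i %/ 2 ^ l = (i %/ 2 ^ l)./2.*2)%N by rewrite halfK (negbTE i_even) subn0.
have jE2 : (j %/ 2 ^ l = (i %/ 2 ^ l)./2.*2.+1)%N by rewrite -iE.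
have := cantor_left_split gamma_gt0 gamma_lt m iE jE2; rewrite lmn.
have /andP[ij ji] := divn_succ_dist (expn_gt0 2 l : (0 < 2 ^ l)%N) jE.
have pm := exp2_gt0 m; have pl := exp2_gt0 l; have pr0 := exp2_gt0 r.
have nE : (2 : R) ^+ n = 2 ^+ l * (2 * 2 ^+ m) by rewrite -exprS -exprD lmn.
have z0 : 0 < (2 ^+ m)^-1 :> R by rewrite invr_gt0.
rewrite gammaXE -exprVn => /andP[tau_ge tau_le].
apply: le_trans (pr_window_ge_scale hB (z := (2 ^+ m)^-1) _ z0 _ _ _).
- have -> : tol r = 2 ^+ r / 2 ^+ n by rewrite gammaXE exp2_depth; field; rewrite gt_eqF.
  by rewrite nE; apply: eq_ler; field; rewrite !gt_eqF.
- exact: (cantor_left_ge0 gamma_gt0 gamma_lt).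
- by rewrite tau_le andbT; apply: le_trans tau_ge; have := exprn_gt0 2 z0; lra.
- rewrite divr_ge0 ?(ltW (exp2_gt0 _))//= ?subr_ge0 ?ler_nat// nE ler_pdivrMr ?mulr_gt0//.
  rewrite (_ : _^-1 * _ = 2 * 2 ^+ l); last by field; rewrite gt_eqF.
  by rewrite lerBlDr -natrX -natrM -natrD ler_nat.
- rewrite (ltW (tol_gt0 r))/= gammaXE lef_pV2 ?posrE ?exprn_gt0// -exprM ler_weXn2l ?ler1n//.
  by rewrite /m /n; lia.
Qed.

Lemma sum_zero_bits_first_hit_le r :
  \sum_(i < 2 ^ depth r) (zero_bits r (depth r) i)%:R * pr P (first_hit r i) <= 12 * expR 8.
Proof.
set n := depth r.
pose p i j := pr P (jump_window B gamma n (tol r) i j).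
pose c : R := expR (- 8) / 3 * 2 ^+ r.
have c0 : 0 < c by rewrite mulr_gt0 ?divr_gt0 ?expR_gt0.
have zero_bits_le i : (i < 2 ^ n)%N ->
    c * (zero_bits r n i)%:R <= \sum_(j < 2 ^ n | (i < j)%N) p i j.
  move=> iN; have := @zero_bits_le_sum_gt R (p i) c r i n (leq_addl _ _).
  rewrite divn_small// mul1n; apply=> [j|l j]; first exact: pr_ge0.
  exact: pr_jump_window_ge.
rewrite -(ler_pM2l c0) mulr_sumr.
apply: (@le_trans _ _ (\sum_(i < 2 ^ n) \sum_(j < 2 ^ n | (i < j)%N)
  pr P (first_hit r i) * p i j)).
  apply: ler_sum => i _; rewrite mulrA mulrC -mulr_sumr ler_wpM2l ?pr_ge0//.
  exact: zero_bits_le.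
rewrite (sum_ord_lt_exchange _ (fun i j => pr P (first_hit r i) * p i j)).
apply: (@le_trans _ _ (\sum_(j < 2 ^ n) 2 * (tol r + tol r))).
  by apply: ler_sum => j _; apply: (sum_first_hits_le hB gamma_gt0 gamma_lt); exact: ltW.
rewrite sumr_const card_ord -[leLHS]mulr_natr natrX /c /n exp2_depth gammaXE expRN.
by apply: eq_ler; have pr0 := exp2_gt0 r; field; rewrite !gt_eqF ?expR_gt0.
Qed.

Lemma pr_level_hit_quarter_le r k : (0 < k)%N ->
  pr P (level_hit B gamma (depth r) (tol r)) <=
  12 * expR 8 / k%:R + 2 * 8 ^+ k * (81 / 128) ^+ r.
Proof.
move=> k0; set n := depth r; have mW := measurable_level_window B gamma n (tol r).
have := pr_bigsetU_seqDU P (2 ^ n) mW measurableT; rewrite setIT -bigcup_mkord => ->.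
apply: (@le_trans _ _ (\sum_(i < 2 ^ n)
   ((zero_bits r n i)%:R * pr P (first_hit r i) / k%:R +
    2 * tol r * 8 ^+ k * 8^-1 ^+ zero_bits r n i))).
  apply: ler_sum => i _; rewrite setIT le_markov_or_bound ?ler1n// pr_ge0/=.
  apply: le_trans (pr_level_window_le hB gamma_gt0 gamma_lt n i (ltW (tol_gt0 r))).
  by apply: le_pr; [exact: seqDU_measurable|exact: mW|exact: subset_seqDU].
rewrite big_split /= -mulr_suml -mulr_sumr lerD//.
  by rewrite ler_wpM2r ?invr_ge0// sum_zero_bits_first_hit_le.
rewrite sum_expr_zero_bits (_ : (1 + 8^-1) ^+ r.*2 = (81 / 64) ^+ r); last first.
  by rewrite -mul2n exprM; congr (_ ^+ _); field.
rewrite (_ : _ * _ = 2 * 8 ^+ k * (tol r * 2 ^+ r * (81 / 64) ^+ r)); last by ring.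
by rewrite -!exprMn; apply: eq_ler; congr (_ * _ ^+ _); field.
Qed.

(* The tolerances and the probabilities of exceeding them must both be summable, which
   requires [1 / 8 < q ^+ 4 < 1] of the ratio [q = 2 / 3] of successive tolerances. *)
Local Notation step_tol r := (fun k => tol r * (2 / 3) ^+ k / 8).

Lemma sum_step_tol_le r k : \sum_(l < k) step_tol r l <= tol r * 3 / 8.
Proof.
rewrite -mulr_suml -mulr_sumr ler_pM2r ?invr_gt0// ler_pM2l//.
by rewrite [leRHS](_ : _ = (1 - 2 / 3)^-1) ?sum_expr_le//; [lra|field].
Qed.

Lemma pr_oscillation_quarter_le r :
  pr P (oscillation B gamma (depth r) (step_tol r)) <= 3 * (128 * 8 ^+ 4) * 2^-1 ^+ r.
Proof.
apply: (pr_oscillation_le hB gamma_gt0 gamma_lt) => [k|m].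
  by rewrite divr_gt0// mulr_gt0// exprn_gt0//; lra.
apply: (@le_trans _ _ (\sum_(k < m) 128 * 8 ^+ 4 * 2^-1 ^+ r * (81 / 128) ^+ k)).
  apply: ler_sum => k _; have pk := exp2_gt0 k; have pr0 := exp2_gt0 r.
  have q0 : 0 < (2 / 3 : R) ^+ k by rewrite exprn_gt0//; lra.
  have -> : (81 / 128 : R) ^+ k = (2 ^+ k) ^- 3 / ((2 / 3) ^+ k) ^+ 4.
    have -> : 81 / 128 = (2 ^+ 3)^-1 / (2 / 3) ^+ 4 :> R by field.
    by rewrite expr_div_n exprVn (exprAC 2 3 k) (exprAC (2 / 3) 4 k).
  rewrite !gammaXE exprD exp2_depth exprVn.
  by apply: eq_ler; field; rewrite !gt_eqF.
rewrite -mulr_sumr -[leRHS]mulrA [leRHS]mulrC ler_wpM2l ?mulr_ge0 ?exprn_ge0//.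
apply: le_trans (sum_expr_le m _) _; first lra.
by rewrite (_ : (1 - 81 / 128)^-1 = 128 / 47); [lra|field].
Qed.

Lemma pr_hit_quarter_le r k : (0 < r)%N -> (0 < k)%N ->
  pr P (hit B gamma) <= 12 * expR 8 / k%:R + 2 * 8 ^+ k * (81 / 128) ^+ r +
                        3 * (128 * 8 ^+ 4) * 2^-1 ^+ r.
Proof.
move=> r0 k0.
apply: le_trans (lerD (pr_level_hit_quarter_le r k0) (pr_oscillation_quarter_le r)).
have mH := measurable_level_hit B gamma (depth r) (tol r).
have mO := measurable_oscillation B gamma (depth r) (step_tol r).
apply: le_trans (pr_setU_le _ mH mO); apply: le_pr.
- exact: (measurable_hit hB gamma_gt0 gamma_lt).
- exact: measurableU.
apply: (hit_sub_level_windows hB gamma_gt0 gamma_lt (Y := tol r * 3 / 8)).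
- by move=> l; rewrite divr_ge0// mulr_ge0 ?(ltW (tol_gt0 r))// exprn_ge0//; lra.
- exact: sum_step_tol_le.
have half_tol : (2 : R) ^- depth r <= tol r / 2; last by have := tol_gt0 r; lra.
rewrite exp2_depth gammaXE -invfM lef_pV2 ?posrE ?mulr_gt0 ?exprn_gt0// [leRHS]exprSr.
by rewrite ler_wpM2l ?exprn_ge0// -[leLHS]expr1 ler_weXn2l// ler1n.
Qed.

Lemma pr_hit_quarter : pr P (hit B gamma) = 0.
Proof.
apply/eqP; rewrite eq_le pr_ge0 andbT; apply/ler_addgt0Pr => e e0; rewrite add0r.
have E0 : 0 < 12 * expR 8 :> R by rewrite mulr_gt0 ?expR_gt0.
have e3 : 0 < e / 3 by rewrite divr_gt0.
have [k _ /(_ k (leqnn k)) /= k_lt] := near_infty_natSinv_lt (PosNum (divr_gt0 e3 E0)).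
have many_lt : 12 * expR 8 / k.+1%:R < e / 3 by rewrite mulrC -ltr_pdivlMr.
have C1 : 0 < 2 * 8 ^+ k.+1 :> R by rewrite mulr_gt0 ?exprn_gt0.
have C2 : 0 < 3 * (128 * 8 ^+ 4) :> R by rewrite !mulr_gt0 ?exprn_gt0.
near \oo => r.
have r0 : (0 < r)%N by near: r; exists 1%N.
have few_lt : 2 * 8 ^+ k.+1 * (81 / 128) ^+ r < e / 3.
  rewrite mulrC -ltr_pdivlMr//; near: r; apply: near_infty_expr_lt; first lra.
  by rewrite divr_gt0.
have rough_lt : 3 * (128 * 8 ^+ 4) * 2^-1 ^+ r < e / 3.
  rewrite mulrC -ltr_pdivlMr//; near: r; apply: near_infty_expr_lt; first lra.
  by rewrite divr_gt0.
apply: le_trans (pr_hit_quarter_le r0 (ltn0Sn k)) _.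
rewrite [leRHS](_ : e = e / 3 + e / 3 + e / 3); last by field.
by rewrite !lerD// ltW.
Unshelve. all: end_near. Qed.

End quarter.

Theorem theorem1p3 (R : realType) (d : measure_display) (T : measurableType d)
    (P : probability T R) (B : R -> {RV P >-> R})
    (hB : standard_brownian_motion B)
    (gamma : R) (hgamma0 : 0 < gamma) (hgamma1 : gamma < 1 / 2) :
  (0 < P [set w | zeros (fun t => B t w - cantor_function gamma t)%R
                  `&` cantor_set gamma !=set0])%E
  <-> gamma <> 1 / 4.
Proof.
rewrite -[X in P X]/(hit B gamma) (prE P (measurable_hit hB hgamma0 hgamma1)) lte_fin.
split=> [hit_gt0 gammaE|/eqP gamma_neq]; last exact: pr_hit_gt0.
by move: hit_gt0; rewrite gammaE pr_hit_quarter// ltxx.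
Qed.
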